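(* Let $n\geq2$. For given constants $\alpha\geq0$ and $a_1,\ldots,a_{n-1}>0$, define $$\phi_j(y)=\int_0^y\frac{dt}{(\frac1{a_j}+t^2)\sqrt{P(t)}},\quad\text{where}\quad P(t)=\frac1{t^2}\Bigl(\prod_{k=1}^{n-1}(1+a_kt^2)e^{\alpha t^2}-1\Bigr),$$ for $j=1,\ldots,n-1$ and $y\in\mathbb{R}$. Then when $\alpha\neq0$, $$(1)\quad L=\Bigl\{\Bigl(x_1\sqrt{\tfrac1{a_1}+y^2}\,e^{i\phi_1(y)},\ldots,x_{n-1}\sqrt{\tfrac1{a_{n-1}}+y^2}\,e^{i\phi_{n-1}(y)},\ \tfrac12y^2-\tfrac12\sum_{j=1}^{n-1}x_j^2-\tfrac i\alpha\sum_{j=1}^{n-1}\phi_j(y)-\tfrac i\alpha\arg\bigl(y+iP(y)^{-1/2}\bigr)\Bigr):x_1,\ldots,x_{n-1},y\in\mathbb{R}\Bigr\}$$ is a closed, embedded Lagrangian in $\mathbb{C}^n$ diffeomorphic to $\mathbb{R}^n$, which is a Lagrangian translating soliton with translating vector $(0,\ldots,0,\alpha)\in\mathbb{C}^n$. When $\alpha=0$, $$L=\Bigl\{\Bigl(x_1\sqrt{\tfrac1{a_1}+y^2}\,e^{i\phi_1(y)},\ldots,x_{n-1}\sqrt{\tfrac1{a_{n-1}}+y^2}\,e^{i\phi_{n-1}(y)},\ \tfrac12y^2-\tfrac12\sum_{j=1}^{n-1}x_j^2+i\int_0^y\frac{dt}{\sqrt{\frac1{t^2}\bigl(\prod_{k=1}^{n-1}(1+a_kt^2)-1\bigr)}}\Bigr):x_1,\ldots,x_{n-1},y\in\mathbb{R}\Bigr\}$$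 is a closed, embedded Lagrangian in $\mathbb{C}^n$ diffeomorphic to $\mathbb{R}^n$, which is special Lagrangian. There exist $\bar\phi_1,\ldots,\bar\phi_{n-1}\in(0,\frac\pi2]$ such that $\phi_j(y)\to\bar\phi_j$ as $y\to\infty$ and $\phi_j(y)\to-\bar\phi_j$ as $y\to-\infty$ for $j=1,\ldots,n-1$. These satisfy $\bar\phi_1+\cdots+\bar\phi_{n-1}<\frac\pi2$ if $\alpha>0$, and $\bar\phi_1+\cdots+\bar\phi_{n-1}=\frac\pi2$ if $\alpha=0$. For fixed $\alpha>0$, the map $(a_1,\ldots,a_{n-1})\mapsto(\bar\phi_1,\ldots,\bar\phi_{n-1})$ is a 1-1 correspondence from $(0,\infty)^{n-1}$ to $\{(\bar\phi_1,\ldots,\bar\phi_{n-1})\in(0,\frac\pi2)^{n-1}:\bar\phi_1+\cdots+\bar\phi_{n-1}<\frac\pi2\}$. When $\alpha=0$, the map has image $\{(\bar\phi_1,\ldots,\bar\phi_{n-1})\in(0,\frac\pi2]^{n-1}:\bar\phi_1+\cdots+\bar\phi_{n-1}=\frac\pi2\}$. The Lagrangian angle of $L$ in (1) varies between $\sum_{j=1}^{n-1}\bar\phi_j$ and $\pi-\sum_{j=1}^{n-1}\bar\phi_j$ (its infimum and supremum). Thus, when $\alpha>0$, by choosing $\sum_{j=1}^{n-1}\bar\phi_j$ close to $\frac\pi2$, the oscillation of the Lagrangian angle of $L$ can be made arbitrarily small.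
   Context: $\mathbb{C}^n$ has coordinates $z_j=x_j+iy_j$, the Euclidean metric, and $\omega=\sum_jdx_j\wedge dy_j$. An $n$-dimensional submanifold $L$ is Lagrangian if $\omega|_L=0$; its Lagrangian angle $\theta$ (for a suitable orientation and continuous real-valued choice) is defined by $dz_1\wedge\cdots\wedge dz_n|_L=e^{i\theta}\mathrm{vol}_L$; it is special Lagrangian if $\theta$ is constant. The oscillation of $\theta$ is $\sup_L\theta-\inf_L\theta$. A translating soliton with translating vector $T$ is a submanifold with $H\equiv T^\perp$, where $H$ is the mean curvature vector and $T^\perp$ the normal component of the constant vector $T$. ''Closed'' means closed as a subset of $\mathbb{C}^n$. $P$ is extended smoothly to $t=0$ (so $P>0$) and $\arg(y+iP(y)^{-1/2})\in(0,\pi)$. *)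

(* Defs.v *)
From HB Require Import structures.
From mathcomp Require Import all_boot all_order all_algebra.
From mathcomp Require Import all_classical all_reals all_analysis.
From mathcomp Require Import complex ring lra.

Set Implicit Arguments.
Unset Strict Implicit.
Unset Printing Implicit Defensive.

Import Order.TTheory GRing.Theory Num.Theory.
Import numFieldNormedType.Exports.

Local Open Scope classical_set_scope.
Local Open Scope ring_scope.
Local Open Scope complex_scope.

(* Throughout, n = m.+1, so that m = n - 1 is the number of parameters a_j.   *)
(* C^n is the real vector space R^n x R^n, the pair (x, y) standing for       *)
(* x + iy; its sup norm induces the Euclidean topology. The types are only    *)
(* used for n >= 1, as 'rV_n is a normed space only for n of the form m.+1.   *)
Notation Cn R n := ('rV[R]_n * 'rV[R]_n)%type.

Section ComplexSpace.
Context {R : realType} {m : nat}.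
Local Notation n := m.+1.
Implicit Types (p v w : Cn R n).

Definition zcoord p (j : 'I_n) : R[i] := p.1 ord0 j +i* p.2 ord0 j.

Definition of_zcoord (z : 'I_n -> R[i]) : Cn R n :=
  (\row_j complex.Re (z j), \row_j complex.Im (z j)).

Definition edot v w : R :=
  \sum_j (v.1 ord0 j * w.1 ord0 j + v.2 ord0 j * w.2 ord0 j).

(* omega = \sum_j dx_j /\ dy_j *)
Definition omega v w : R :=
  \sum_j (v.1 ord0 j * w.2 ord0 j - v.2 ord0 j * w.1 ord0 j).

End ComplexSpace.

Section Calculus.
Context {R : realType} {m : nat}.
Local Notation n := m.+1.

Definition partial {V : normedModType R} (j : 'I_n) (f : 'rV[R]_n -> V)
    (u : 'rV[R]_n) : V :=
  'D_(delta_mx ord0 j) f u.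

Fixpoint Ck {V : normedModType R} (k : nat) (f : 'rV[R]_n -> V) : Prop :=
  if k is k'.+1 then
    (forall u, differentiable f u) /\ (forall j, Ck k' (partial j f))
  else continuous f.

Definition smooth {V : normedModType R} (f : 'rV[R]_n -> V) : Prop :=
  forall k, Ck k f.

End Calculus.

Section Submanifolds.
Context {R : realType} {m : nat}.
Local Notation n := m.+1.
Implicit Types (F : 'rV[R]_n -> Cn R n) (L : set (Cn R n)).

(* F is a smooth injective immersion, a homeomorphism onto its image. *)
Definition smooth_embedding F : Prop :=
  [/\ smooth F,
      (forall u v : 'rV[R]_n, 'D_v F u = 0 -> v = 0) &
      exists G : Cn R n -> 'rV[R]_n, cancel F G /\ {within range F, continuous G}].

(* L is an embedded submanifold and F is a diffeomorphism from R^n to L. *)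
Definition parametrizes F L : Prop := smooth_embedding F /\ range F = L.

Definition metric F (u : 'rV[R]_n) : 'M[R]_n :=
  \matrix_(i, j) edot (partial i F u) (partial j F u).

(* The normal component w^\perp = w - \sum_(i, j) g^{ij} <w, d_i F> d_j F. *)
Definition normal_part F (u : 'rV[R]_n) (w : Cn R n) : Cn R n :=
  w - \sum_i \sum_j
        (invmx (metric F u) i j * edot w (partial i F u)) *: partial j F u.

(* The trace of the second fundamental form, without the factor 1/n:          *)
(* H = \sum_(i, j) g^{ij} (d_i d_j F)^\perp.                                  *)
Definition mean_curvature F (u : 'rV[R]_n) : Cn R n :=
  \sum_i \sum_j
    invmx (metric F u) i j *: normal_part F u (partial i (partial j F) u).

(* dz_1 /\ ... /\ dz_n on the frame (d_1 F, ..., d_n F). *)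
Definition dz_frame F (u : 'rV[R]_n) : R[i] :=
  \det (\matrix_(j, k) zcoord (partial k F u) j).

(* The following properties of a submanifold L diffeomorphic to R^n do not    *)
(* depend on the parametrization, so each is expressed in some parametrization *)
(* of the whole of L.                                                         *)

Definition embedded_Rn L : Prop := exists F, parametrizes F L.

Definition lagrangian L : Prop :=
  exists2 F, parametrizes F L &
    forall u v w : 'rV[R]_n, omega ('D_v F u) ('D_w F u) = 0.

(* H = T^\perp *)
Definition translating_soliton (T : Cn R n) L : Prop :=
  exists2 F, parametrizes F L &
    forall u, mean_curvature F u = normal_part F u T.

Definition expi (t : R) : R[i] := cos t +i* sin t.

(* theta is a continuous function on L (its values off L are irrelevant) with *)
(* dz_1 /\ ... /\ dz_n = e^{i theta} vol_L on L. In the parametrization F,    *)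
(* vol_L = +- sqrt (det g) du_1 /\ ... /\ du_n, where the sign, encoded by o, *)
(* is that of the orientation chosen on the connected manifold L.             *)
Definition lagrangian_angle L (theta : Cn R n -> R) : Prop :=
  {within L, continuous theta} /\
  exists2 F, parametrizes F L &
    exists o : bool, forall u,
      dz_frame F u =
        expi (theta (F u)) * ((-1) ^+ o * Num.sqrt (\det (metric F u)))%:C.

Definition special_lagrangian L : Prop :=
  lagrangian L /\ exists c : R, lagrangian_angle L (fun=> c).

Definition sup_on L (theta : Cn R n -> R) : \bar R :=
  ereal_sup [set (theta p)%:E | p in L].

Definition inf_on L (theta : Cn R n -> R) : \bar R :=
  ereal_inf [set (theta p)%:E | p in L].

Definition oscillation L (theta : Cn R n -> R) : \bar R :=
  (sup_on L theta - inf_on L theta)%E.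

End Submanifolds.

Section OneVariable.
Context {R : realType}.

(* The oriented integral of f from 0 to y, for y of any sign. *)
Definition integral0 (f : R -> R) (y : R) : R :=
  if 0 <= y then Rintegral (@lebesgue_measure R) `[0, y] f
  else - Rintegral (@lebesgue_measure R) `[y, 0] f.

(* The principal argument, in ]-pi, pi]. *)
Definition arg (z : R[i]) : R :=
  let t := acos (complex.Re z /
                 Num.sqrt (complex.Re z ^+ 2 + complex.Im z ^+ 2)) in
  if 0 <= complex.Im z then t else - t.

Lemma arg_upper (x y : R) : 0 < y ->
  0 < arg (x +i* y) < pi /\
  x +i* y = (Num.sqrt (x ^+ 2 + y ^+ 2))%:C * expi (arg (x +i* y)).
Proof.
move=> y0; rewrite /arg /= (ltW y0).
set r := Num.sqrt _.
have s0 : 0 < x ^+ 2 + y ^+ 2 by rewrite ltr_wpDl ?sqr_ge0 ?exprn_gt0.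
have r0 : 0 < r by rewrite sqrtr_gt0.
have r2 : r ^+ 2 = x ^+ 2 + y ^+ 2 by rewrite sqr_sqrtr // ltW.
have xr : -1 < x / r < 1.
  rewrite -ltr_norml normrM normfV (gtr0_norm r0) ltr_pdivrMr // mul1r.
  rewrite -sqrtr_sqr ltr_sqrt //.
  by rewrite ltrDl exprn_gt0.
have xr' : -1 <= x / r <= 1 by case/andP: xr => /ltW -> /ltW ->.
split.
  case/andP: xr => h1 h2.
  by rewrite acos_gt0 ?acos_ltpi ?h1 ?h2 ?(ltW h1) ?(ltW h2).
rewrite /expi acosK // sin_acos //.
have rn : r != 0 by rewrite gt_eqF.
have -> : 1 - (x / r) ^+ 2 = (y / r) ^+ 2.
  rewrite !expr_div_n.
  have -> : x ^+ 2 = r ^+ 2 - y ^+ 2 by rewrite r2; ring.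
  by field.
rewrite sqrtr_sqr gtr0_norm ?divr_gt0 //.
apply/eqP; rewrite eq_complex /= !mul0r subr0 addr0.
by rewrite [r * (x / r)]mulrC [r * (y / r)]mulrC !divfK // !eqxx.
Qed.

End OneVariable.

Section Solitons.
Context {R : realType} {m : nat}.
Variables (alpha : R) (a : 'rV[R]_m).

(* At t = 0 this is the value of the smooth extension. *)
Definition P (t : R) : R :=
  if t == 0 then alpha + \sum_k a ord0 k
  else (t ^+ 2)^-1 *
       ((\prod_k (1 + a ord0 k * t ^+ 2)) * expR (alpha * t ^+ 2) - 1).

Definition phi (j : 'I_m) (y : R) : R :=
  integral0
    (fun t => (((a ord0 j)^-1 + t ^+ 2) * Num.sqrt (P t))^-1) y.

Definition phibar : 'rV[R]_m := \row_j lim (phi j y @[y --> +oo]).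

(* The point of C^(m.+1) whose first m coordinates are                        *)
(* x_j sqrt (1 / a_j + y^2) e^{i phi_j(y)} and whose last one is z.           *)
Definition soliton_point (x : 'rV[R]_m) (y : R) (z : R[i]) : Cn R m.+1 :=
  of_zcoord (fun k : 'I_m.+1 =>
    if unlift ord_max k is Some j
    then (x ord0 j * Num.sqrt ((a ord0 j)^-1 + y ^+ 2))%:C * expi (phi j y)
    else z).

Definition L_pos : set (Cn R m.+1) :=
  [set p | exists (x : 'rV[R]_m) (y : R),
     p = soliton_point x y
       ((y ^+ 2 / 2 - (\sum_j x ord0 j ^+ 2) / 2) +i*
        (- (alpha^-1 * \sum_j phi j y)
         - alpha^-1 * arg (y +i* (Num.sqrt (P y))^-1)))].

(* (0, ..., 0, alpha) *)
Definition translating_vector : Cn R m.+1 :=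
  of_zcoord (fun k => if k == ord_max then alpha%:C else 0).

End Solitons.

(* Here P 0 a t = (\prod_k (1 + a_k t^2) - 1) / t^2 for t != 0.               *)
Definition L_zero {R : realType} {m : nat} (a : 'rV[R]_m) : set (Cn R m.+1) :=
  [set p | exists (x : 'rV[R]_m) (y : R),
     p = soliton_point 0 a x y
       ((y ^+ 2 / 2 - (\sum_j x ord0 j ^+ 2) / 2) +i*
        integral0 (fun t => (Num.sqrt (P 0 a t))^-1) y)].

Definition all_pos {R : realType} {m : nat} (a : 'rV[R]_m) : Prop :=
  forall k, 0 < a ord0 k.

Definition rowsum {R : realType} {m : nat} (a : 'rV[R]_m) : R :=
  \sum_k a ord0 k.

(* Main.v *)
Require Import Defs.
From HB Require Import structures.
From mathcomp Require Import all_boot all_order all_algebra.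
From mathcomp Require Import all_classical all_reals all_analysis.
From mathcomp Require Import complex ring lra.

Set Implicit Arguments.
Unset Strict Implicit.
Unset Printing Implicit Defensive.

Import Order.TTheory GRing.Theory Num.Theory.
Import numFieldNormedType.Exports.

Local Open Scope classical_set_scope.
Local Open Scope ring_scope.

(** Write psi for the primitive of 1 / sqrt P that vanishes at 0. Since
    1 + y^2 P(y) = prod_k (1 + a_k y^2) e^(alpha y^2), logarithmic
    differentiation gives

      phi_1(y) + ... + phi_m(y) + alpha psi(y) = atan (y sqrt P(y))   [sum_phi],

    and the right-hand side is pi/2 - arg (y + i P(y)^(-1/2)). Everything follows
    from this relation.

    Geometry. It shows that the last coordinate of L_pos is, up to a constant,
    y^2/2 - |x|^2/2 + i psi(y), as for L_zero, so both are images of one map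
    F(x, y). This map is proper and injective, hence a closed embedding
    [soliton_map_closed, soliton_map_embedding]; it is Lagrangian because
    |w_j|^2 phi_j' = psi' for the profile curves
    w_j = sqrt(1/a_j + y^2) e^(i phi_j). The form dz_1 ... dz_n factors on its
    frame into terms of argument phi_1, ..., phi_m and arg (y + i psi')
    [soliton_map_dz], so its Lagrangian angle is pi/2 - alpha psi(y): constant for
    alpha = 0, and strictly decreasing in y for alpha > 0, where the extreme
    values are its limits. The induced metric is a rank-one perturbation of a
    diagonal matrix, so its inverse is explicit and H = T^perp becomes the
    derivative of the relation above [soliton_map_translating].

    Limit angles. For y >= 0 all the terms of the relation are nonnegative, so
    phi_j < pi/2 and the limits exist; their sum is pi/2 minus the limit of
    alpha psi.

    The map a |-> phibar. It is monotone: phibar_j decreases in the a_k with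
    k <> j, and for alpha > 0 the sum of all phibar_j strictly increases in each
    a_k. Comparing two preimages with their join gives injectivity [phibar_inj].
    For surjectivity, the supremum of the subsolutions phibar(a) <= b is a
    solution, by the method of Perron [monotone_system_solvable]; the only
    continuity that this needs is phibar_j(a') <= lambda phibar_j(a) for
    a <= a' with a'_j <= lambda a_j. For alpha = 0 one parameter is kept fixed. *)

(** * Calculus of one variable *)

Section OneVariableCalculus.
Context {R : realType}.
Implicit Types f g df dg : R -> R.

Lemma is_derive_continuous f df :
  (forall x : R, is_derive x 1 f (df x)) -> continuous f.
Proof.
move=> fd x; apply: differentiable_continuous; apply/derivable1_diffP.
by case: (fd x).
Qed.

Lemma is_derive_ndecr f df a b : (forall x : R, is_derive x 1 f (df x)) ->
  a <= b -> (forall x, a <= x <= b -> 0 <= df x) -> f a <= f b.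
Proof.
move=> fd ab df0; rewrite -subr_ge0.
have cf := continuous_subspaceT (A := `[a, b]) (is_derive_continuous fd).
have [c + ->] := @MVT_segment R f df a b ab (fun x _ => fd x) cf.
by rewrite in_itv /= => cab; rewrite mulr_ge0 ?subr_ge0 ?df0.
Qed.

Lemma is_derive_incr f df a b : (forall x : R, is_derive x 1 f (df x)) ->
  a < b -> (forall x, a < x < b -> 0 < df x) -> f a < f b.
Proof.
move=> fd ab df0; rewrite -subr_gt0.
have cf := continuous_subspaceT (A := `[a, b]) (is_derive_continuous fd).
have [c + ->] := @MVT R f df a b ab (fun x _ => fd x) cf.
by rewrite in_itv /= => cab; rewrite mulr_gt0 ?subr_gt0 ?df0.
Qed.

Lemma is_derive_le f g df dg y :
  (forall x : R, is_derive x 1 f (df x)) -> (forall x : R, is_derive x 1 g (dg x)) ->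
  f 0 = g 0 -> 0 <= y -> (forall x, 0 <= x <= y -> df x <= dg x) ->
  f y <= g y.
Proof.
move=> fd gd fg0 y0 dfg.
have hd (x : R) : is_derive x 1 (g - f) (dg x - df x) by apply: is_deriveB.
have := is_derive_ndecr hd y0.
rewrite !fctE fg0 subrr subr_ge0; apply=> x xy.
by rewrite subr_ge0 dfg.
Qed.

Lemma is_derive_eq_fun f g df :
  (forall x : R, is_derive x 1 f (df x)) -> (forall x : R, is_derive x 1 g (df x)) ->
  f 0 = g 0 -> f =1 g.
Proof.
move=> fd gd fg0 y.
have hd (x : R) : is_derive x 1 (g - f) 0.
  by rewrite -(subrr (df x)); apply: is_deriveB.
have := is_derive_0_is_cst y 0 hd.
by rewrite !fctE fg0 subrr => /eqP; rewrite subr_eq0 => /eqP.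
Qed.

Lemma is_derive_comp f g (a b x : R) :
  is_derive (g x) 1 f a -> is_derive x 1 g b ->
  is_derive x 1 (fun y => f (g y)) (a * b).
Proof.
move=> fa gb.
exact: (@is_derive1_comp R f g x a b).
Qed.

Lemma is_deriveM1 f g (a b x : R) :
  is_derive x 1 f a -> is_derive x 1 g b ->
  is_derive x 1 (fun y => f y * g y) (a * g x + f x * b).
Proof.
move=> fa gb; apply: (@is_derive_eq _ _ _ (f * g)) => /=.
by rewrite /GRing.scale /=; ring.
Qed.

Lemma is_deriveD1 f g (a b x : R) :
  is_derive x 1 f a -> is_derive x 1 g b ->
  is_derive x 1 (fun y => f y + g y) (a + b).
Proof. by move=> fa gb; apply: (@is_deriveD _ _ _ f g). Qed.

Lemma is_deriveV1 f (a x : R) : f x != 0 ->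
  is_derive x 1 f a -> is_derive x 1 (fun y => (f y)^-1) (- a * (f x)^-1 ^+ 2).
Proof.
move=> f0 fa; apply: is_derive_eq.
by rewrite /GRing.scale /= -exprVn; ring.
Qed.

Lemma is_derive_sqrt1 f (a x : R) : 0 < f x ->
  is_derive x 1 f a ->
  is_derive x 1 (fun y => Num.sqrt (f y)) (a / 2 * (Num.sqrt (f x))^-1).
Proof.
move=> f0 fa; apply: is_derive_eq.
  by apply: (is_derive_comp _ fa); apply: is_derive1_sqrt.
by rewrite -mulr_natl invfM mulrC mulrA.
Qed.

Lemma integral0_at0 f : Defs.integral0 f 0 = 0.
Proof. by rewrite /Defs.integral0 lexx set_itv1 Rintegral_set1. Qed.

(** Splitting the integral at a point -M left of both 0 and y removes the case
    distinction on the sign of y. *)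
Lemma is_derive_integral0 f (y : R) : continuous f ->
  is_derive y 1 (Defs.integral0 f) (f y).
Proof.
move=> cf.
pose M : R := `|y| + 1.
pose mu := @lebesgue_measure R.
have M0 : 0 < M by rewrite /M ltr_pwDr.
have yM : `|y| < M by rewrite ltrDl.
have intf a b : mu.-integrable `[a, b] (EFin \o f).
  apply: continuous_compact_integrable; first exact: segment_compact.
  by apply: continuous_subspaceT.
pose F : R -> R := fun x => Rintegral mu `[- M, x] f.
have Fy : derivable F y 1 /\ derive1 F y = f y.
  apply: (@continuous_FTC1_closed R f (- M) y M).
  - by move: yM; rewrite ltr_norml => /andP[].
  - exact: intf.
  - by move: yM; rewrite ltr_norml => /andP[].
  - exact: cf.
have split (x z : R) : - M < x -> x <= z -> F z - F x = Rintegral mu `[x, z] f.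
  move=> Mx xz.
  rewrite /F Rintegral_itvB ?bnd_simp//; [|exact: ltW].
  apply: Rintegral_itv_obnd_cbnd.
  by apply: integrableS (intf x z) => //; apply: subset_itvr; rewrite bnd_simp.
apply: (@near_eq_is_derive R R R (fun x => F x - F 0)).
  near=> x.
  have xM : `|x| < M.
    near: x; apply: (@cvgr_lt R _ _ _ (fun x : R => `|x|) `|y|) => //.
    exact: norm_continuous.
  have xM1 : - M < x by move: xM; rewrite ltr_norml => /andP[].
  rewrite /Defs.integral0; case: ifP => x0.
    by rewrite split// oppr_lt0.
  by rewrite -split ?opprB// ltW// ltNge x0.
have dF : is_derive y 1 F (f y).
  by case: Fy => dF <-; rewrite derive1E; apply: DeriveDef.
rewrite -[f y]subr0.
by apply: (@is_deriveB _ _ _ F (cst (F 0))).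
Unshelve. all: by end_near. Qed.

Lemma integral0_odd f : continuous f -> (forall x, f (- x) = f x) ->
  forall y, Defs.integral0 f (- y) = - Defs.integral0 f y.
Proof.
move=> cf ef; apply: (@is_derive_eq_fun _ _ (fun x => - f x)) => [x|x|].
- rewrite -ef -[_ (- x)]mulr1 -mulrN.
  apply: (is_derive_comp (is_derive_integral0 _ cf)).
- exact/is_deriveN/is_derive_integral0.
- by rewrite oppr0 integral0_at0 oppr0.
Qed.

End OneVariableCalculus.

Section MonotoneLimits.
Context {R : realType}.
Implicit Types f : R -> R.

Lemma ndecr_bounded_cvg f (K : R) :
  {homo f : x y / x <= y} -> (forall y, f y <= K) ->
  f y @[y --> +oo] --> lim (f y @[y --> +oo]).
Proof.
move=> fi fK.
have hub : has_ubound (range f) by exists K => _ [x _ <-].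
by have := nondecreasing_cvgr fi hub => /cvgP.
Qed.

Lemma ndecr_le_lim f (l : R) :
  {homo f : x y / x <= y} -> f y @[y --> +oo] --> l -> forall y, f y <= l.
Proof.
move=> fi fl y; rewrite -(cvg_lim (@Rhausdorff R) fl).
apply: limr_ge; first by apply/cvgP; exact: fl.
by near=> z; apply: fi; near: z; by apply: nbhs_pinfty_ge; rewrite num_real.
Unshelve. all: by end_near. Qed.

Lemma lim_le_bound f (l K : R) :
  f y @[y --> +oo] --> l -> (forall y, 0 <= y -> f y <= K) -> l <= K.
Proof.
move=> fl fK; rewrite -(cvg_lim (@Rhausdorff R) fl).
apply: limr_le; first by apply/cvgP; exact: fl.
by near=> z; apply: fK; near: z; by apply: nbhs_pinfty_ge; rewrite num_real.
Unshelve. all: by end_near. Qed.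

End MonotoneLimits.

(** * Smooth functions of one variable *)

Section SmoothFunctionsOfOneVariable.
Context {R : realType}.
Implicit Types f g : R -> R.

(** Generated by constants, exp, sin, cos and entire series under the operations
    used below. Primitives give access to phi_j and psi, and the series are needed
    for (e^x - 1) / x, which makes P smooth at 0. *)
Inductive smooth1 : (R -> R) -> Prop :=
| Smooth1_cst c : smooth1 (fun=> c)
| Smooth1_add f g : smooth1 f -> smooth1 g -> smooth1 (fun x => f x + g x)
| Smooth1_mul f g : smooth1 f -> smooth1 g -> smooth1 (fun x => f x * g x)
| Smooth1_inv f : smooth1 f -> (forall x, f x != 0) ->
    smooth1 (fun x => (f x)^-1)
| Smooth1_sqrt f : smooth1 f -> (forall x, 0 < f x) ->
    smooth1 (fun x => Num.sqrt (f x))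
| Smooth1_comp f g : smooth1 f -> smooth1 g -> smooth1 (fun x => f (g x))
| Smooth1_exp : smooth1 expR
| Smooth1_sin : smooth1 sin
| Smooth1_cos : smooth1 cos
| Smooth1_entire (c : nat -> R) : (forall n, `|c n| <= (n`!%:R)^-1) ->
    smooth1 (fun x => limn (pseries c x))
| Smooth1_primitive f g : smooth1 g -> (forall x : R, is_derive x 1 f (g x)) ->
    smooth1 f.

Lemma is_cvg_pseries_fact (c : nat -> R) (x : R) :
  (forall n, `|c n| <= (n`!%:R)^-1) -> cvgn (pseries c x).
Proof.
move=> cn; apply: normed_cvg.
apply: (@series_le_cvg _ _ (exp_coeff `|x|)).
- by move=> n /=.
- by move=> n; rewrite exp_coeff_ge0.
- move=> n; rewrite /exp_coeff /= normrM normrX mulrC.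
  by rewrite ler_wpM2l ?exprn_ge0.
- exact: is_cvg_series_exp_coeff.
Qed.

(** The bound 1 / n! passes to the coefficients of the derived series. *)
Lemma pseries_diffs_fact (c : nat -> R) :
  (forall n, `|c n| <= (n`!%:R)^-1) ->
  forall n, `|pseries_diffs c n| <= (n`!%:R)^-1.
Proof.
move=> cn n; rewrite /pseries_diffs normrM normr_nat.
apply: le_trans (ler_wpM2l _ (cn n.+1)) _ => //.
by rewrite factS natrM invfM mulrA divff ?mul1r// pnatr_eq0.
Qed.

(** The inductive class is stable under derivation, so its members have
    derivatives of all orders. *)
Lemma smooth1_derive f : smooth1 f ->
  exists2 df, smooth1 df & forall x : R, is_derive x 1 f (df x).
Proof.
elim=> {f} [c|f g sf [df sdf fD] sg [dg sdg gD]|f g sf [df sdf fD] sg [dg sdg gD]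
  |f sf [df sdf fD] f0|f sf [df sdf fD] f0
  |f g sf [df sdf fD] sg [dg sdg gD]||||c cn|f g sg _ fD].
- by exists (fun=> 0) => [|x]; [apply: Smooth1_cst|apply: is_derive_cst].
- exists (fun x => df x + dg x) => [|x]; first exact: Smooth1_add.
  exact: is_deriveD1.
- exists (fun x => df x * g x + f x * dg x) => [|x].
    by apply: Smooth1_add; apply: Smooth1_mul.
  exact: is_deriveM1.
- exists (fun x => - 1 * df x * ((f x)^-1 * (f x)^-1)) => [|x].
    apply: Smooth1_mul; last by apply: Smooth1_mul; apply: Smooth1_inv.
    by apply: Smooth1_mul => //; apply: Smooth1_cst.
  by rewrite mulN1r -expr2; apply: is_deriveV1.
- exists (fun x => df x * 2^-1 * (Num.sqrt (f x))^-1) => [|x].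
    apply: Smooth1_mul; first by apply: Smooth1_mul => //; apply: Smooth1_cst.
    apply: Smooth1_inv; first exact: Smooth1_sqrt.
    by move=> x; rewrite gt_eqF// sqrtr_gt0.
  exact: is_derive_sqrt1.
- exists (fun x => df (g x) * dg x) => [|x]; last exact: is_derive_comp.
  by apply: Smooth1_mul => //; apply: Smooth1_comp.
- by exists expR => [|x]; [apply: Smooth1_exp|apply: is_derive_expR].
- by exists cos => [|x]; [apply: Smooth1_cos|apply: is_derive_sin].
- exists (fun x => - 1 * sin x) => [|x]; last first.
    by rewrite mulN1r; apply: is_derive_cos.
  by apply: Smooth1_mul; [apply: Smooth1_cst|apply: Smooth1_sin].
- have dn := pseries_diffs_fact cn.
  exists (fun x => limn (pseries (pseries_diffs c) x)) => [|x].
    exact: Smooth1_entire.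
  apply: (@pseries_snd_diffs _ _ (`|x| + 1)).
  + exact: is_cvg_pseries_fact.
  + exact: is_cvg_pseries_fact.
  + by apply: is_cvg_pseries_fact; apply: pseries_diffs_fact.
  + by rewrite [X in _ < X]ger0_norm ?addr_ge0// ltrDl.
- by exists g.
Qed.

Lemma smooth1_continuous f : smooth1 f -> continuous f.
Proof. by move=> /smooth1_derive[df _ fD]; apply: is_derive_continuous fD. Qed.

Lemma smooth1_id : smooth1 id.
Proof. by apply: (@Smooth1_primitive _ (fun=> 1)); first exact: Smooth1_cst. Qed.

Lemma smooth1_sqr : smooth1 (fun x => x ^+ 2).
Proof. by apply: (@Smooth1_mul id id); exact: smooth1_id. Qed.

Lemma smooth1_integral0 f : smooth1 f -> smooth1 (Defs.integral0 f).
Proof.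
move=> sf; apply: (Smooth1_primitive sf) => x.
exact/is_derive_integral0/smooth1_continuous.
Qed.

(** The entire function (e^x - 1) / x. *)
Definition exprel (x : R) := limn (pseries (fun n => (n.+1`!%:R)^-1) x).

Lemma exprel_coef_le n : `|(n.+1`!%:R)^-1 : R| <= (n`!%:R)^-1.
Proof.
rewrite ger0_norm ?invr_ge0 ?ler0n// lef_pV2 ?posrE ?ltr0n ?fact_gt0//.
by rewrite ler_nat factS leq_pmull.
Qed.

Lemma smooth1_exprel : smooth1 exprel.
Proof. by apply: Smooth1_entire => n; apply: exprel_coef_le. Qed.

Lemma exprelE x : x * exprel x = expR x - 1.
Proof.
have cvq : pseries (fun n => (n.+1`!%:R)^-1) x @ \oo --> exprel x.
  by apply: is_cvg_pseries_fact => n; apply: exprel_coef_le.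
apply/eqP; rewrite eq_sym subr_eq addrC; apply/eqP.
rewrite /expR; apply: cvg_lim => //.
rewrite -cvg_shiftS /=.
have -> : (fun n => series (exp_coeff x) n.+1) =
    (fun n => 1 + x * pseries (fun n => (n.+1`!%:R)^-1) x n).
  apply/funext => n; rewrite /series /= big_nat_recl// /exp_coeff /=.
  rewrite expr0 fact0 divr1 mulr_sumr; congr (_ + _).
  by apply: eq_bigr => i _; rewrite /= exprS -mulrA; congr (_ * _); rewrite mulrC.
by apply: cvgD; [exact: cvg_cst|apply: cvgM => //; exact: cvg_cst].
Qed.

Lemma exprel0 : exprel 0 = 1.
Proof.
apply: cvg_lim => //; rewrite -cvg_shiftS /=.
have -> : (fun n => pseries (fun n => (n.+1`!%:R)^-1) (0 : R) n.+1) = cst 1.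
  apply/funext => n; rewrite /pseries /series /= big_nat_recl//=.
  rewrite expr0 factS fact0 muln1 invr1 mulr1 big1 ?addr0// => i _.
  by rewrite expr0n /= mulr0.
exact: cvg_cst.
Qed.

End SmoothFunctionsOfOneVariable.

(** * The function P *)

Section Profile.
Context {R : realType} {m : nat}.
Variables (alpha : R) (a : 'rV[R]_m).

Definition growth (s : R) : R :=
  (\prod_k (1 + a ord0 k * s)) * expR (alpha * s).

Lemma P_growth t : t ^+ 2 * P alpha a t = growth (t ^+ 2) - 1.
Proof.
rewrite /P; case: eqP => [->|/eqP t0]; last first.
  by rewrite mulrA divff ?mul1r// expf_neq0.
rewrite expr2 !mul0r /growth big1 ?mulr0 ?expR0 ?mulr1 ?subrr// => k _.
by rewrite mulr0 addr0.
Qed.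

Lemma P_even t : P alpha a (- t) = P alpha a t.
Proof. by rewrite /P oppr_eq0 sqrrN. Qed.

(** Division of a product by s, so that P is visibly smooth across t = 0. *)
Lemma prod_quotient (r : seq 'I_m) : exists q : R -> R, [/\ smooth1 q,
  forall s, \prod_(k <- r) (1 + a ord0 k * s) = 1 + s * q s &
  q 0 = \sum_(k <- r) a ord0 k].
Proof.
elim: r => [|k r [q [sq qE q0]]].
  exists (fun=> 0); split; [exact: Smooth1_cst| |by rewrite big_nil].
  by move=> s; rewrite big_nil mulr0 addr0.
exists (fun s => q s + a ord0 k * (1 + s * q s)); split.
- apply: Smooth1_add => //; apply: Smooth1_mul; first exact: Smooth1_cst.
  apply: Smooth1_add; first exact: Smooth1_cst.
  by apply: Smooth1_mul => //; exact: smooth1_id.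
- by move=> s; rewrite big_cons qE; ring.
- by rewrite big_cons q0; ring.
Qed.

(** With prod_k (1 + a_k s) = 1 + s q(s), the quotient defining P(t) is
    q(s) e^(alpha s) + (e^(alpha s) - 1) / s for s = t^2. *)
Lemma smooth1_P : smooth1 (P alpha a).
Proof.
have [q [sq qE q0]] := prod_quotient (index_enum 'I_m).
have -> : P alpha a = fun t => q (t ^+ 2) * expR (alpha * t ^+ 2) +
    alpha * exprel (alpha * t ^+ 2).
  apply/funext => t.
  have [->|t0] := eqVneq t 0.
    by rewrite /P eqxx expr0n /= mulr0 expR0 exprel0 q0; ring.
  have t20 : t ^+ 2 != 0 by rewrite expf_neq0.
  apply: (mulfI t20); rewrite P_growth /growth qE mulrDr.
  have -> : t ^+ 2 * (alpha * exprel (alpha * t ^+ 2)) =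
    (alpha * t ^+ 2) * exprel (alpha * t ^+ 2) by ring.
  by rewrite exprelE; ring.
have s2 := @smooth1_sqr R.
have sa : smooth1 (fun t : R => alpha * t ^+ 2).
  by apply: Smooth1_mul => //; exact: Smooth1_cst.
apply: Smooth1_add; apply: Smooth1_mul.
- exact: (Smooth1_comp sq s2).
- exact: (Smooth1_comp Smooth1_exp sa).
- exact: Smooth1_cst.
- exact: (Smooth1_comp smooth1_exprel sa).
Qed.

End Profile.

Section ProfileBounds.
Context {R : realType} {m : nat}.
Variables (alpha : R) (alpha0 : 0 <= alpha).
Implicit Types a c : 'rV[R]_m.

Lemma prod_ge1D a (s : R) (j : 'I_m) : all_pos a -> 0 <= s ->
  1 + a ord0 j * s <= \prod_k (1 + a ord0 k * s).
Proof.
move=> ap s0.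
have a1 k : 1 <= 1 + a ord0 k * s by rewrite lerDl mulr_ge0// ltW.
rewrite (bigD1 j)//= ler_peMr ?(le_trans ler01)//.
by apply: (big_ind (fun x => 1 <= x)) => // x y; apply: mulr_ege1.
Qed.

Lemma prod_ge1 a (s : R) : all_pos a -> 0 <= s ->
  1 <= \prod_k (1 + a ord0 k * s).
Proof.
move=> ap s0; apply: (big_ind (fun x => 1 <= x)) => // [x y|k _].
  exact: mulr_ege1.
by rewrite lerDl mulr_ge0// ltW.
Qed.

Lemma growth_ge1 a s : all_pos a -> 0 <= s -> 1 <= growth alpha a s.
Proof.
move=> ap s0; rewrite /growth mulr_ege1 ?prod_ge1//.
by rewrite -expR0 ler_expR mulr_ge0.
Qed.

Lemma P_ge_alpha a t : all_pos a -> alpha <= P alpha a t.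
Proof.
move=> ap; have [->|t0] := eqVneq t 0.
  by rewrite /P eqxx lerDl sumr_ge0// => k _; rewrite ltW.
have t20 : 0 < t ^+ 2 by rewrite exprn_even_gt0.
rewrite -(ler_pM2l t20) P_growth /growth lerBrDl mulrC.
apply: le_trans (expR_ge1Dx _) _.
by rewrite ler_peMl ?expR_ge0// prod_ge1// ltW.
Qed.

Lemma P_ge_exp a (j : 'I_m) t : all_pos a ->
  a ord0 j * expR (alpha * t ^+ 2) <= P alpha a t.
Proof.
move=> ap; have [->|t0] := eqVneq t 0.
  rewrite /P eqxx expr0n /= mulr0 expR0 mulr1 (bigD1 j)//= addrCA.
  by rewrite lerDl addr_ge0// sumr_ge0// => k _; rewrite ltW.
have t20 : 0 < t ^+ 2 by rewrite exprn_even_gt0.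
rewrite -(ler_pM2l t20) P_growth /growth lerBrDl.
have e1 : 1 <= expR (alpha * t ^+ 2).
  by rewrite -expR0 ler_expR mulr_ge0// ltW.
apply: (@le_trans _ _ ((1 + a ord0 j * t ^+ 2) * expR (alpha * t ^+ 2))).
  by rewrite mulrDl mul1r mulrA [_ * a _ _]mulrC lerD2r.
by rewrite ler_pM2r ?expR_gt0// prod_ge1D// ltW.
Qed.

Lemma P_ge_coef a (j : 'I_m) t : all_pos a -> a ord0 j <= P alpha a t.
Proof.
move=> ap; apply: le_trans (P_ge_exp j t ap).
by rewrite ler_peMr ?(ltW (ap _))// -expR0 ler_expR mulr_ge0// sqr_ge0.
Qed.


Lemma P_le a c t : all_pos a -> (forall k, a ord0 k <= c ord0 k) ->
  P alpha a t <= P alpha c t.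
Proof.
move=> ap ac; have [->|t0] := eqVneq t 0.
  by rewrite /P eqxx lerD2l; apply: ler_sum.
have t20 : 0 < t ^+ 2 by rewrite exprn_even_gt0.
rewrite -(ler_pM2l t20) !P_growth lerD2r ler_pM2r ?expR_gt0//.
apply: ler_prod => k _.
have := ltW (ap k); have := ltW t20 => t2 ak.
by rewrite lerD2l ler_pM2r// ac andbT addr_ge0// mulr_ge0.
Qed.

Lemma P_lt a c t : all_pos a -> (forall k, a ord0 k <= c ord0 k) ->
  (exists k, a ord0 k < c ord0 k) -> P alpha a t < P alpha c t.
Proof.
move=> ap ac [j acj]; have [->|t0] := eqVneq t 0.
  by rewrite /P eqxx ltrD2l (bigD1 j)//= [ltRHS](bigD1 j)//= ltr_leD// ler_sum.
have t20 : 0 < t ^+ 2 by rewrite exprn_even_gt0.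
have cp : all_pos c by move=> k; apply: lt_le_trans (ap k) (ac k).
rewrite -(ltr_pM2l t20) !P_growth ltrD2r ltr_pM2r ?expR_gt0//.
rewrite (bigD1 j)//= [ltRHS](bigD1 j)//=.
have p0 : 0 < \prod_(k | k != j) (1 + a ord0 k * t ^+ 2).
  by apply: prodr_gt0 => k _; rewrite addr_gt0// mulr_gt0.
apply: (@lt_le_trans _ _
  ((1 + c ord0 j * t ^+ 2) * \prod_(k | k != j) (1 + a ord0 k * t ^+ 2))).
  by rewrite ltr_pM2r// ltrD2l ltr_pM2r.
rewrite ler_pM2l; last by rewrite addr_gt0// mulr_gt0.
apply: ler_prod => k _.
have := ltW (ap k); have := ltW t20 => t2 ak.
by rewrite lerD2l ler_pM2r// ac andbT addr_ge0// mulr_ge0.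
Qed.

End ProfileBounds.

(** * The angles phi_j and the relation between them *)

Section Angles.
Context {R : realType} {m : nat} (hm : (0 < m)%N).
Variables (alpha : R) (a : 'rV[R]_m).
Hypotheses (alpha0 : 0 <= alpha) (ap : all_pos a).
Local Notation P := (P alpha a).
Local Notation phi := (phi alpha a).

Definition psi (y : R) : R := Defs.integral0 (fun t => (Num.sqrt (P t))^-1) y.

Lemma P_gt0 t : 0 < P t.
Proof. by apply: lt_le_trans (P_ge_coef alpha0 (Ordinal hm) t ap); apply: ap. Qed.

Lemma sqrtP_gt0 t : 0 < Num.sqrt (P t).
Proof. by rewrite sqrtr_gt0 P_gt0. Qed.

Lemma radius2_gt0 j (t : R) : 0 < (a ord0 j)^-1 + t ^+ 2.
Proof. by rewrite ltr_pwDl ?sqr_ge0// invr_gt0. Qed.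

Lemma smooth1_dpsi : smooth1 (fun t => (Num.sqrt (P t))^-1).
Proof.
apply: Smooth1_inv => [|t]; last by rewrite gt_eqF ?sqrtP_gt0.
by apply: Smooth1_sqrt; [exact: smooth1_P|exact: P_gt0].
Qed.

Lemma smooth1_radius2 j : smooth1 (fun t : R => (a ord0 j)^-1 + t ^+ 2).
Proof. by apply: Smooth1_add; [exact: Smooth1_cst|exact: smooth1_sqr]. Qed.

Lemma smooth1_dphi j :
  smooth1 (fun t => (((a ord0 j)^-1 + t ^+ 2) * Num.sqrt (P t))^-1).
Proof.
apply: Smooth1_inv => [|t]; last first.
  by rewrite gt_eqF// mulr_gt0 ?sqrtP_gt0 ?radius2_gt0.
apply: Smooth1_mul; first exact: smooth1_radius2.
by apply: Smooth1_sqrt; [exact: smooth1_P|exact: P_gt0].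
Qed.

Lemma smooth1_phi j : smooth1 (phi j).
Proof. by apply: smooth1_integral0; exact: smooth1_dphi. Qed.

Lemma smooth1_psi : smooth1 psi.
Proof. by apply: smooth1_integral0; exact: smooth1_dpsi. Qed.

Lemma is_derive_phi j (y : R) :
  is_derive y 1 (phi j) (((a ord0 j)^-1 + y ^+ 2) * Num.sqrt (P y))^-1.
Proof.
by have := is_derive_integral0 y (smooth1_continuous (smooth1_dphi j)).
Qed.

Lemma is_derive_psi (y : R) : is_derive y 1 psi (Num.sqrt (P y))^-1.
Proof. by have := is_derive_integral0 y (smooth1_continuous smooth1_dpsi). Qed.

Lemma phi_at0 j : phi j 0 = 0. Proof. exact: integral0_at0. Qed.

Lemma psi_at0 : psi 0 = 0. Proof. exact: integral0_at0. Qed.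

Lemma phi_odd j y : phi j (- y) = - phi j y.
Proof.
apply: integral0_odd => [|x]; first exact/smooth1_continuous/smooth1_dphi.
by rewrite sqrrN P_even.
Qed.

Lemma psi_odd y : psi (- y) = - psi y.
Proof.
apply: integral0_odd => [|x]; first exact/smooth1_continuous/smooth1_dpsi.
by rewrite P_even.
Qed.

Lemma phi_ndecr j : {homo phi j : x y / x <= y}.
Proof.
move=> x y xy; apply: (is_derive_ndecr (is_derive_phi j)) => // z _.
by rewrite invr_ge0 ltW// mulr_gt0 ?sqrtP_gt0 ?radius2_gt0.
Qed.

Lemma phi_incr j : {homo phi j : x y / x < y}.
Proof.
move=> x y xy; apply: (is_derive_incr (is_derive_phi j)) => // z _.
by rewrite invr_gt0 mulr_gt0 ?sqrtP_gt0 ?radius2_gt0.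
Qed.

Lemma psi_incr : {homo psi : x y / x < y}.
Proof.
move=> x y xy; apply: (is_derive_incr is_derive_psi) => // z _.
by rewrite invr_gt0 sqrtP_gt0.
Qed.

Lemma is_derive_growth (y : R) : is_derive y 1
  (fun y => growth alpha a (y ^+ 2)) (growth alpha a (y ^+ 2) * (2 * y) *
    (\sum_k a ord0 k / (1 + a ord0 k * y ^+ 2) + alpha)).
Proof.
have pos k : 0 < 1 + a ord0 k * y ^+ 2.
  by rewrite ltr_pwDl// mulr_ge0 ?sqr_ge0// ltW.
have dsq (c : R) : is_derive y 1 (fun y : R => c * y ^+ 2) (c * (2 * y)).
  have d2 := is_deriveM1 (is_derive_id y 1) (is_derive_id y 1).
  apply: is_derive_eq (is_deriveM1 (is_derive_cst c y 1) d2) _.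
  by rewrite /cst; ring.
have dprod (r : seq 'I_m) : is_derive y 1
    (fun y => \prod_(k <- r) (1 + a ord0 k * y ^+ 2))
    (\prod_(k <- r) (1 + a ord0 k * y ^+ 2) * (2 * y) *
     \sum_(k <- r) a ord0 k / (1 + a ord0 k * y ^+ 2)).
  elim: r => [|k r IH].
    rewrite !big_nil mulr0; under eq_fun do rewrite big_nil.
    exact: is_derive_cst.
  under eq_fun do rewrite big_cons.
  have dk := is_deriveD1 (is_derive_cst (1 : R) y 1) (dsq (a ord0 k)).
  apply: is_derive_eq (is_deriveM1 dk IH) _.
  rewrite !big_cons /cst; field.
  by rewrite gt_eqF.
have dexp := is_derive_comp (is_derive_expR _) (dsq alpha).
apply: is_derive_eq (is_deriveM1 (dprod _) dexp) _.
by rewrite /growth; ring.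
Qed.

(** Since y^2 P(y) + 1 is the product growth(y^2), the function y sqrt P(y) is
    the tangent of the angle whose derivative is the sum of the phi_j' and of
    alpha psi'; at y = 0 the derivative comes from P(0) instead, because the
    identity for (y sqrt P)^2 is singular there. *)
Lemma is_derive_ysqrtP (y : R) : is_derive y 1 (fun y => y * Num.sqrt (P y))
  (growth alpha a (y ^+ 2) / Num.sqrt (P y) *
    (\sum_k a ord0 k / (1 + a ord0 k * y ^+ 2) + alpha)).
Proof.
have [dP _ PD] := smooth1_derive (smooth1_P alpha a).
pose dr := Num.sqrt (P y) + y * (dP y / 2 * (Num.sqrt (P y))^-1).
have rD : is_derive y 1 (fun y => y * Num.sqrt (P y)) dr.
  have dsq := is_derive_sqrt1 (P_gt0 y) (PD y).
  by apply: is_derive_eq (is_deriveM1 (is_derive_id y 1) dsq) _; rewrite mul1r.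
have s0 := sqrtP_gt0 y.
apply: (is_derive_eq rD _).
have [y0|y0] := eqVneq y 0.
  rewrite /dr y0 mul0r addr0 expr0n /= /growth mulr0 expR0 mulr1.
  rewrite big1 => [|k _]; last by rewrite mulr0 addr0.
  under eq_bigr do rewrite mulr0 addr0 divr1.
  have P0 : \sum_k a ord0 k + alpha = P 0 by rewrite /Defs.P eqxx addrC.
  have q2 : Num.sqrt (P y) ^+ 2 = P y by rewrite sqr_sqrtr ?ltW ?P_gt0.
  rewrite P0 -y0; set q := Num.sqrt (P y) in s0 q2 *; rewrite -q2.
  by field; rewrite gt_eqF.
have e1 : is_derive y 1 (fun y => growth alpha a (y ^+ 2))
    (2 * (y * Num.sqrt (P y)) * dr).
  have -> : (fun y => growth alpha a (y ^+ 2)) =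
     (fun y => 1 + (y * Num.sqrt (P y)) * (y * Num.sqrt (P y))).
    apply/funext => z; rewrite -[growth _ _ _](subrK 1) -P_growth.
    by rewrite -{1}[P z]sqr_sqrtr ?ltW ?P_gt0//; ring.
  have d1 := is_deriveD1 (is_derive_cst (1 : R) y 1) (is_deriveM1 rD rD).
  by apply: (is_derive_eq d1); ring.
have := is_derive_growth y.
move=> /(@derive_val _ _ _ _ _ _ _); rewrite (@derive_val _ _ _ _ _ _ _ e1).
set S := \sum_k _ + _ => E.
have n0 : 2 * (y * Num.sqrt (P y)) != 0.
  by rewrite !mulf_neq0 ?pnatr_eq0// gt_eqF.
apply: (mulfI n0); rewrite E.
by field; rewrite gt_eqF.
Qed.

(** Both sides vanish at 0 and have the same derivative. *)
Lemma sum_phi y :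
  \sum_j phi j y + alpha * psi y = atan (y * Num.sqrt (P y)).
Proof.
have g0 z : growth alpha a (z ^+ 2) != 0.
  by rewrite gt_eqF// (lt_le_trans ltr01)// growth_ge1// sqr_ge0.
pose d z := \sum_j (((a ord0 j)^-1 + z ^+ 2) * Num.sqrt (P z))^-1 +
  alpha * (Num.sqrt (P z))^-1.
apply: (@is_derive_eq_fun _ (fun y => \sum_j phi j y + alpha * psi y)
  (fun y => atan (y * Num.sqrt (P y))) d) => [z|z|].
- apply: is_deriveD1.
    have := @is_derive_sum _ _ _ m phi z 1 _ (fun j => is_derive_phi j z).
    by rewrite fct_sumE.
  apply: is_derive_eq.
    exact: is_deriveM1 (is_derive_cst _ _ _) (is_derive_psi z).
  by rewrite mul0r add0r.
- apply: is_derive_eq.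
    exact: is_derive_comp (is_derive1_atan _) (is_derive_ysqrtP z).
  rewrite exprMn sqr_sqrtr ?ltW ?P_gt0// P_growth addrC subrK /d.
  rewrite -[_ / _ * _]mulrA mulKf// mulrDr mulr_sumr; congr (_ + _); last first.
    by rewrite mulrC.
    apply: eq_bigr => k _; rewrite invfM mulrC; congr (_ * _).
    have := ap k => ak.
    have h : 0 < 1 + a ord0 k * z ^+ 2 by rewrite ltr_pwDl// mulr_ge0 ?sqr_ge0// ltW.
    have h' := radius2_gt0 k z.
    by field; rewrite !gt_eqF//=; nra.
- by rewrite psi_at0 mulr0 addr0 mul0r atan0 big1// => j _; apply: phi_at0.
Qed.

Lemma arg_atan (x y : R) : 0 < y ->
  Defs.arg (x +i* y)%C = pi / 2 - atan (x / y).
Proof.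
move=> y0; rewrite /Defs.arg /= (ltW y0).
set t := atan (x / y).
have tI : - (pi / 2) < t < pi / 2 by rewrite atan_gtNpi2 atan_ltpi2.
have ct : 0 < cos t by apply: cos_gt0_pihalf.
have -> : x / Num.sqrt (x ^+ 2 + y ^+ 2) = cos (pi / 2 - t).
  have -> : cos (pi / 2 - t) = sin t.
    by rewrite cosB cos_pihalf sin_pihalf mul0r add0r mul1r.
  have -> : sin t = tan t * cos t by rewrite /tan divfK// gt_eqF.
  rewrite atanK cos_atan.
  have -> : x ^+ 2 + y ^+ 2 = y ^+ 2 * (1 + (x / y) ^+ 2).
    by field; rewrite gt_eqF.
  rewrite sqrtrM ?sqr_ge0// sqrtr_sqr gtr0_norm//.
  by rewrite invfM mulrA.
rewrite cosK// in_itv /=; lra.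
Qed.

(** This is the Lagrangian angle of the solitons, see soliton_param_angle. *)
Lemma angle_psi y : \sum_j phi j y +
  Defs.arg (y +i* (Num.sqrt (P y))^-1)%C = pi / 2 - alpha * psi y.
Proof.
rewrite arg_atan ?invr_gt0 ?sqrtP_gt0// invrK -sum_phi.
by ring.
Qed.

End Angles.

(** * Limits of the angles *)

Section AngleLimits.
Context {R : realType} {m : nat} (hm : (0 < m)%N).
Variables (alpha : R) (a : 'rV[R]_m).
Hypotheses (alpha0 : 0 <= alpha) (ap : all_pos a).
Local Notation P := (P alpha a).
Local Notation phi := (phi alpha a).
Local Notation phibar := (phibar alpha a).
Local Notation psi := (psi alpha a).

Lemma phi_ge0 j y : 0 <= y -> 0 <= phi j y.
Proof.
by move=> y0; rewrite -(phi_at0 alpha a j); apply: phi_ndecr.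
Qed.

Lemma psi_ge0 y : 0 <= y -> 0 <= psi y.
Proof.
rewrite le_eqVlt => /predU1P[<-|y0]; first by rewrite psi_at0.
by rewrite -(psi_at0 alpha a) ltW// psi_incr.
Qed.

(** For y >= 0, phi_j(y) is at most the whole left-hand side of sum_phi. *)
Lemma phi_lt_pihalf j y : phi j y < pi / 2.
Proof.
have [y0|y0] := leP 0 y; last first.
  apply: (@le_lt_trans _ _ 0); last by rewrite divr_gt0 ?pi_gt0.
  by rewrite -(phi_at0 alpha a j); apply: phi_ndecr => //; exact: ltW.
apply: le_lt_trans (atan_ltpi2 (y * Num.sqrt (P y))).
rewrite -(sum_phi hm alpha0 ap) (bigD1 j)//= -addrA lerDl addr_ge0//.
  by apply: sumr_ge0 => k _; exact: phi_ge0.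
by rewrite mulr_ge0// psi_ge0.
Qed.

Lemma phi_cvgy j : phi j y @[y --> +oo] --> phibar ord0 j.
Proof.
rewrite mxE; apply: (@ndecr_bounded_cvg _ _ (pi / 2)).
  exact: phi_ndecr.
by move=> y; rewrite ltW// phi_lt_pihalf.
Qed.

Lemma phi_le_phibar j y : phi j y <= phibar ord0 j.
Proof.
exact: ndecr_le_lim (@phi_ndecr _ _ hm _ _ alpha0 ap j) (@phi_cvgy j) y.
Qed.

Lemma phibar_le_bound j (K : R) :
  (forall y, 0 <= y -> phi j y <= K) -> phibar ord0 j <= K.
Proof. exact: lim_le_bound (@phi_cvgy j). Qed.

Lemma phi_cvgNy j : phi j y @[y --> -oo] --> - phibar ord0 j.
Proof.
rewrite -[phi j]opprK; apply: cvgN.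
apply/cvgNy_compNP.
have -> : (- phi j) \o -%R = phi j.
  by apply/funext => y /=; rewrite !fctE phi_odd// opprK.
exact: phi_cvgy.
Qed.

Lemma phibar_gt0 j : 0 < phibar ord0 j.
Proof.
apply: (@lt_le_trans _ _ (phi j 1)).
  by rewrite -(phi_at0 alpha a j); apply: phi_incr.
exact: phi_le_phibar.
Qed.

Lemma ysqrtP_cvgy : (y * Num.sqrt (P y)) @[y --> +oo] --> +oo.
Proof.
have a0 := ap (Ordinal hm).
have s0 : 0 < Num.sqrt (a ord0 (Ordinal hm)) by rewrite sqrtr_gt0.
apply: (@ger_cvgy _ _ _ _ (fun y => y * Num.sqrt (a ord0 (Ordinal hm)))).
  near=> y; rewrite ler_pM2l.
    by rewrite ler_wsqrtr// P_ge_coef.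
  by near: y; apply: nbhs_pinfty_gt; rewrite num_real.
by apply: gt0_cvgMly s0 _; exact: cvg_id.
Unshelve. all: by end_near. Qed.

(** The limit of sum_phi, whose right-hand side tends to pi / 2. *)
Lemma alpha_psi_cvgy :
  alpha * psi y @[y --> +oo] --> pi / 2 - rowsum phibar.
Proof.
have -> : (fun y => alpha * psi y) =
    (fun y => atan (y * Num.sqrt (P y)) - \sum_j phi j y).
  by apply/funext => y; rewrite -(sum_phi hm alpha0 ap); ring.
apply: cvgB.
  exact: cvg_comp ysqrtP_cvgy (@cvgy_atan R).
apply: cvg_big; first exact: add_continuous.
by move=> j _; exact: phi_cvgy.
Qed.

Lemma alpha_psi_ndecr : {homo (fun y => alpha * psi y) : x y / x <= y}.
Proof.
move=> x y; rewrite le_eqVlt => /predU1P[->//|xy].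
by rewrite ler_wpM2l// ltW// psi_incr.
Qed.

Lemma alpha_psi_le y : alpha * psi y <= pi / 2 - rowsum phibar.
Proof. exact: ndecr_le_lim alpha_psi_ndecr alpha_psi_cvgy y. Qed.

Lemma rowsum_phibar_lt : 0 < alpha -> rowsum phibar < pi / 2.
Proof.
move=> al; rewrite -subr_gt0; apply: lt_le_trans (alpha_psi_le 1).
by rewrite mulr_gt0// -(psi_at0 alpha a) psi_incr.
Qed.

Lemma rowsum_phibar_eq : alpha = 0 -> rowsum phibar = pi / 2.
Proof.
move=> al; have := alpha_psi_cvgy; rewrite {1}al.
under eq_fun do rewrite mul0r.
move=> /(cvg_lim (@Rhausdorff R)); rewrite lim_cst//.
by move/eqP; rewrite eq_sym subr_eq0 eq_sym => /eqP.
Qed.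

Lemma phibar_lt_rowsum j : phibar ord0 j <= rowsum phibar.
Proof.
rewrite /rowsum (bigD1 j)//= lerDl sumr_ge0// => k _.
by rewrite ltW// phibar_gt0.
Qed.

Lemma is_derive_atan_scale (b K y : R) :
  is_derive y 1 (fun y => K * atan (b * y)) (K * (b / (1 + (b * y) ^+ 2))).
Proof.
have d1 := is_deriveM1 (is_derive_cst b y 1) (is_derive_id y 1).
have d2 := is_derive_comp (is_derive1_atan _) d1.
have d3 := is_deriveM1 (is_derive_cst K y 1) d2.
by apply: (is_derive_eq d3); rewrite /cst; ring.
Qed.

(** Comparison of phi_j with an arctangent of slope sqrt a_j. *)
Lemma phibar_le_sqrt (p : R) j : 0 < p -> (forall t, p <= P t) ->
  phibar ord0 j <= Num.sqrt (a ord0 j) / Num.sqrt p * (pi / 2).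
Proof.
move=> p0 pP; set s := Num.sqrt (a ord0 j).
have s0 : 0 < s by rewrite sqrtr_gt0.
have sp : 0 < Num.sqrt p by rewrite sqrtr_gt0.
have s2 : s ^+ 2 = a ord0 j by rewrite sqr_sqrtr ?ltW.
have sp0 : 0 <= s / Num.sqrt p by rewrite divr_ge0 ?ltW.
apply: phibar_le_bound => y y0.
apply: (@le_trans _ _ (s / Num.sqrt p * atan (s * y))); last first.
  by rewrite ler_wpM2l// ltW// atan_ltpi2.
apply: (is_derive_le (is_derive_phi hm alpha0 ap j)
  (is_derive_atan_scale s (s / Num.sqrt p))) => // [|x _].
  by rewrite phi_at0 mulr0 atan0 mulr0.
have -> : s / Num.sqrt p * (s / (1 + (s * x) ^+ 2)) =
    (((a ord0 j)^-1 + x ^+ 2) * Num.sqrt p)^-1.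
  rewrite -s2; field; rewrite !gt_eqF//=.
  by rewrite ltr_pwDl// sqr_ge0.
rewrite lef_pV2 ?posrE ?mulr_gt0 ?radius2_gt0 ?sqrtP_gt0//.
by rewrite ler_pM2l ?radius2_gt0// ler_wsqrtr.
Qed.

(** For alpha > 0 the factor e^(alpha y^2) in P makes psi bounded by a multiple
    of a_j^(-1/2), so the sum of the limit angles tends to pi/2 as any of the
    parameters tends to infinity. *)
Lemma rowsum_phibar_ge j : 0 < alpha ->
  pi / 2 - rowsum phibar <=
  alpha / (Num.sqrt (a ord0 j) * Num.sqrt (alpha / 2)) * (pi / 2).
Proof.
move=> al; set s := Num.sqrt (a ord0 j); set b := Num.sqrt (alpha / 2).
have s0 : 0 < s by rewrite sqrtr_gt0.
have b0 : 0 < b by rewrite sqrtr_gt0 divr_gt0.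
have b2 : b ^+ 2 = alpha / 2 by rewrite sqr_sqrtr// ltW// divr_gt0.
have sb0 : 0 <= (s * b)^-1 by rewrite invr_ge0 mulr_ge0 ?ltW.
apply: (lim_le_bound alpha_psi_cvgy) => y y0.
rewrite -mulrA ler_pM2l//.
apply: (@le_trans _ _ ((s * b)^-1 * atan (b * y))); last first.
  by rewrite ler_wpM2l// ltW// atan_ltpi2.
apply: (is_derive_le (is_derive_psi hm alpha0 ap)
  (is_derive_atan_scale b (s * b)^-1)) => // [|x _].
  by rewrite psi_at0 mulr0 atan0 mulr0.
have d0 : 0 < 1 + (b * x) ^+ 2 by rewrite ltr_pwDl// sqr_ge0.
have -> : (s * b)^-1 * (b / (1 + (b * x) ^+ 2)) = (s * (1 + (b * x) ^+ 2))^-1.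
  by field; rewrite !gt_eqF//= -exprMn.
rewrite lef_pV2 ?posrE ?sqrtP_gt0 ?mulr_gt0//.
have e1 : 1 + (b * x) ^+ 2 <= expR ((b * x) ^+ 2) by exact: expR_ge1Dx.
apply: (@le_trans _ _ (s * expR ((b * x) ^+ 2))); first by rewrite ler_pM2l.
have -> : s * expR ((b * x) ^+ 2) =
    Num.sqrt (a ord0 j * expR (alpha * x ^+ 2)).
  rewrite sqrtrM ?ltW//; congr (_ * _).
  have -> : expR (alpha * x ^+ 2) = expR ((b * x) ^+ 2) ^+ 2.
    by rewrite -expRM_natl exprMn b2; congr expR; field.
  by rewrite sqrtr_sqr ger0_norm// expR_ge0.
by rewrite ler_wsqrtr// P_ge_exp.
Qed.

End AngleLimits.

Section AngleMonotonicity.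
Context {R : realType} {m : nat} (hm : (0 < m)%N).
Variables (alpha : R) (alpha0 : 0 <= alpha).
Implicit Types a c : 'rV[R]_m.

(** With lambda = 1 this says that phibar_j decreases in the other parameters;
    with lambda > 1 it is a one-sided modulus of continuity, which spares any
    further continuity argument. *)
Lemma phibar_le_scale a c (lambda : R) j : all_pos a ->
  (forall k, a ord0 k <= c ord0 k) -> 1 <= lambda ->
  c ord0 j <= lambda * a ord0 j ->
  phibar alpha c ord0 j <= lambda * phibar alpha a ord0 j.
Proof.
move=> ap ac l1 cl.
have cp : all_pos c by move=> k; apply: lt_le_trans (ap k) (ac k).
have l0 : 0 < lambda by apply: lt_le_trans l1.
apply: phibar_le_bound => // y y0.
apply: (@le_trans _ _ (lambda * phi alpha a j y)); last first.
  rewrite ler_pM2l//.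
  exact: phi_le_phibar.
have dl (x : R) := is_deriveM1 (is_derive_cst lambda x 1)
  (is_derive_phi hm alpha0 ap j x).
apply: (is_derive_le (is_derive_phi hm alpha0 cp j) dl) => // [|x _].
  by rewrite !phi_at0 mulr0.
have ra := radius2_gt0 ap j x; have rc := radius2_gt0 cp j x.
have sa := sqrtP_gt0 hm alpha0 ap x; have sc := sqrtP_gt0 hm alpha0 cp x.
rewrite mul0r add0r /cst ler_pdivlMr ?mulr_gt0// mulrC ler_pdivrMr ?mulr_gt0//.
rewrite mulrA; apply: ler_pM; [exact: ltW|exact: ltW| |].
  2: by rewrite ler_wsqrtr// P_le.
rewrite mulrDr lerD ?ler_peMl ?sqr_ge0//.
by rewrite ler_pdivlMr ?cp// mulrC ler_pdivrMr ?ap.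
Qed.

(** The sum of the phibar_j is pi / 2 minus the limit of alpha psi, and psi' = P^(-1/2)
    decreases in the parameters; the gap created on [0, 1] persists at infinity. *)
Lemma rowsum_phibar_incr a c : 0 < alpha -> all_pos a ->
  (forall k, a ord0 k <= c ord0 k) -> (exists k, a ord0 k < c ord0 k) ->
  rowsum (phibar alpha a) < rowsum (phibar alpha c).
Proof.
move=> al ap ac acj.
have cp : all_pos c by move=> k; apply: lt_le_trans (ap k) (ac k).
have dlt x : (Num.sqrt (P alpha c x))^-1 < (Num.sqrt (P alpha a x))^-1.
  by rewrite ltf_pV2 ?posrE ?sqrtP_gt0// ltr_sqrt ?P_gt0// P_lt.
have dD (x : R) : is_derive x 1 (psi alpha a - psi alpha c)
    ((Num.sqrt (P alpha a x))^-1 - (Num.sqrt (P alpha c x))^-1).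
  by apply: is_deriveB; apply: is_derive_psi.
have d1 : 0 < psi alpha a 1 - psi alpha c 1.
  have := is_derive_incr dD ltr01.
  rewrite !fctE !psi_at0 subrr; apply=> x _.
  by rewrite subr_gt0.
rewrite -subr_gt0; set d := psi alpha a 1 - psi alpha c 1 in d1 *.
suff h : pi / 2 - rowsum (phibar alpha c) <=
    pi / 2 - rowsum (phibar alpha a) - alpha * d.
  have e0 : 0 < alpha * d by rewrite mulr_gt0.
  have shift (p q u v : R) : 0 < q -> p - v <= p - u - q -> 0 < v - u.
    by clear; lra.
  exact: shift e0 h.
apply: (lim_le_bound (alpha_psi_cvgy hm alpha0 cp)) => y y0.
apply: (@le_trans _ _ (alpha * psi alpha a (Num.max 1 y) - alpha * d)); last first.
  by rewrite lerD2r; apply: alpha_psi_le.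
rewrite -mulrBr; apply: (@le_trans _ _ (alpha * psi alpha c (Num.max 1 y))).
  by apply: alpha_psi_ndecr; rewrite // le_max lexx orbT.
rewrite ler_pM2l// lerBrDr -lerBrDl.
have := @is_derive_ndecr _ _ _ 1 (Num.max 1 y) dD.
rewrite !fctE; apply; first by rewrite le_max lexx.
by move=> x _; rewrite subr_ge0 ltW.
Qed.

End AngleMonotonicity.

(** * Solving monotone systems of equations *)

Section MonotoneSystems.
Context {R : realType} {m : nat}.
Implicit Types (a b c : 'rV[R]_m) (J : pred 'I_m).

Definition join_row a c : 'rV[R]_m := \row_k Num.max (a ord0 k) (c ord0 k).

Lemma join_row_gel a c k : a ord0 k <= join_row a c ord0 k.
Proof. by rewrite mxE le_max lexx. Qed.

Lemma join_row_ger a c k : c ord0 k <= join_row a c ord0 k.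
Proof. by rewrite mxE le_max lexx orbT. Qed.

Lemma join_row_or a c k :
  join_row a c ord0 k = a ord0 k \/ join_row a c ord0 k = c ord0 k.
Proof. by rewrite mxE /Num.max; case: ifP; [right|left]. Qed.

(** The method of Perron. The subsolutions of Phi a = b on the coordinates of J
    are stable under joins, because Phi_j decreases when the other coordinates
    increase; the one-sided continuity in the hypothesis on Phi shows that
    their supremum is a subsolution, and that a subsolution with a strict
    inequality could still be raised. *)
Lemma monotone_system_solvable J (Phi : 'rV[R]_m -> 'rV[R]_m) b a0 (B : R) :
  (forall a c (lambda : R) j, all_pos a -> (forall k, a ord0 k <= c ord0 k) ->
     1 <= lambda -> c ord0 j <= lambda * a ord0 j ->
     Phi c ord0 j <= lambda * Phi a ord0 j) ->
  (forall a j, all_pos a -> 0 < Phi a ord0 j) ->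
  all_pos a0 -> (forall j, J j -> Phi a0 ord0 j <= b ord0 j) ->
  (forall a, all_pos a -> (forall j, ~~ J j -> a ord0 j = a0 ord0 j) ->
     (forall j, J j -> Phi a ord0 j <= b ord0 j) ->
     forall j, J j -> a ord0 j <= B) ->
  exists a, [/\ all_pos a, forall j, ~~ J j -> a ord0 j = a0 ord0 j &
    forall j, J j -> Phi a ord0 j = b ord0 j].
Proof.
move=> PhiL Phi0 a0p a0b bdd.
pose U := [set a | [/\ all_pos a, forall j, ~~ J j -> a ord0 j = a0 ord0 j &
  forall j, J j -> Phi a ord0 j <= b ord0 j]].
have Ua0 : U a0 by split.
have b0 j : J j -> 0 < b ord0 j.
  by move=> Jj; apply: lt_le_trans (Phi0 _ j a0p) (a0b j Jj).
have Ujoin a c : U a -> U c -> U (join_row a c).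
  move=> [ap aJ ab] [cp cJ cb]; split.
  - by move=> k; apply: lt_le_trans (ap k) (join_row_gel _ _ _).
  - by move=> k Jk; rewrite mxE aJ// cJ// maxxx.
  - move=> j Jj; case: (join_row_or a c j) => E.
      apply: le_trans (ab j Jj); rewrite -[leRHS]mul1r.
      by apply: PhiL => //; [exact: join_row_gel|rewrite E mul1r].
    apply: le_trans (cb j Jj); rewrite -[leRHS]mul1r.
    by apply: PhiL => //; [exact: join_row_ger|rewrite E mul1r].
pose S k := [set a ord0 k | a in U].
have Ssup k : has_sup (S k).
  split; first by exists (a0 ord0 k), a0.
  case: (boolP (J k)) => Jk.
    by exists B => _ [a [ap aJ ab] <-]; apply: bdd.
  by exists (a0 ord0 k) => _ [a [ap aJ ab] <-]; rewrite aJ.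
pose s : 'rV[R]_m := \row_k sup (S k).
have Us a k : U a -> a ord0 k <= s ord0 k.
  by move=> Ua; rewrite mxE; apply: ub_le_sup; [case: (Ssup k)|exists a].
have sp : all_pos s by move=> k; apply: lt_le_trans (a0p k) (Us _ _ Ua0).
have sJ j : ~~ J j -> s ord0 j = a0 ord0 j.
  move=> Jj; apply/eqP; rewrite eq_le Us// andbT mxE.
  apply: ge_sup; first by exists (a0 ord0 j), a0.
  by move=> _ [a [_ aJ _] <-]; rewrite aJ.
(* Joining one almost optimal subsolution for each coordinate. *)
have approx (lambda : R) : 1 < lambda ->
    exists2 c, U c & forall k, s ord0 k <= lambda * c ord0 k.
  move=> l1; have l0 : 0 < lambda by apply: lt_trans l1.
  have [c Uc cs] : exists2 c, U c &
      forall k, k \in index_enum 'I_m -> s ord0 k <= lambda * c ord0 k.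
    elim: (index_enum 'I_m) => [|k r [c Uc cs]]; first by exists a0.
    have e0 : 0 < s ord0 k - s ord0 k / lambda.
      by rewrite subr_gt0 ltr_pdivrMr// ltr_pMr.
    have [_ [d Ud <-]] := sup_adherent e0 (Ssup k).
    have -> : sup (S k) = s ord0 k by rewrite mxE.
    rewrite opprB addrC subrK => dk.
    exists (join_row d c); first exact: Ujoin.
    move=> i; rewrite inE => /predU1P[->|ir].
      apply: (@le_trans _ _ (lambda * d ord0 k)).
        by rewrite mulrC -ler_pdivrMr// ltW.
      by rewrite ler_pM2l// join_row_gel.
    apply: le_trans (cs i ir) _.
    by rewrite ler_pM2l// join_row_ger.
  by exists c => // k; apply: cs; rewrite mem_index_enum.
have sb j : J j -> Phi s ord0 j <= b ord0 j.
  move=> Jj; rewrite leNgt; apply/negP => bs.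
  (* Any lambda strictly between 1 and Phi_j(s) / b_j would do. *)
  pose lambda := (1 + Phi s ord0 j / b ord0 j) / 2.
  have bj := b0 j Jj.
  have q1 : 1 < Phi s ord0 j / b ord0 j by rewrite ltr_pdivlMr// mul1r.
  have l1 : 1 < lambda by rewrite /lambda; clear -q1; lra.
  have lq : lambda < Phi s ord0 j / b ord0 j by rewrite /lambda; clear -q1; lra.
  have [c Uc cs] := approx _ l1; have [cp _ cb] := Uc.
  have := PhiL c s lambda j cp (fun k => Us c k Uc) (ltW l1) (cs j).
  apply/negP; rewrite -ltNge.
  apply: le_lt_trans (_ : lambda * b ord0 j < _).
    by rewrite ler_pM2l ?cb// (lt_trans ltr01).
  by rewrite -ltr_pdivlMr.
have UsU : U s by [].
exists s; split=> // j Jj; apply/eqP; rewrite eq_le sb//= leNgt; apply/negP => sbj.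
(* Multiplying s_j by this factor keeps s a subsolution, but s is maximal. *)
pose lambda := b ord0 j / Phi s ord0 j.
have P0 := Phi0 s j sp.
have l1 : 1 < lambda by rewrite ltr_pdivlMr// mul1r.
pose c : 'rV[R]_m := \row_k (if k == j then lambda * s ord0 k else s ord0 k).
have sc k : s ord0 k <= c ord0 k.
  by rewrite [c _ _]mxE; case: ifP => // _; rewrite ler_peMl ?ltW.
have Uc : U c.
  split.
  - by move=> k; apply: lt_le_trans (sp k) (sc k).
  - move=> k Jk; rewrite mxE ifN ?sJ//.
    by apply: contra Jk => /eqP ->.
  - move=> k Jk; have [kj|kj] := eqVneq k j.
      apply: le_trans (PhiL s c lambda k sp sc (ltW l1) _) _.
        by rewrite [c _ _]mxE kj eqxx.
      by rewrite kj divfK// gt_eqF.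
    apply: le_trans (PhiL s c 1 k sp sc (lexx _) _) _.
      by rewrite [c _ _]mxE (negbTE kj) mul1r.
    by rewrite mul1r sb.
have := Us c j Uc; rewrite [c _ _]mxE eqxx.
by apply/negP; rewrite -ltNge ltr_pMl.
Qed.

End MonotoneSystems.

(** * The map from the parameters to the limit angles *)

Section LimitAngleMap.
Context {R : realType} {m : nat} (hm : (0 < m)%N).
Implicit Types a b c : 'rV[R]_m.

Lemma phibar_join_le (alpha : R) a c j : 0 <= alpha -> all_pos a -> all_pos c ->
  phibar alpha (join_row a c) ord0 j <=
  Num.max (phibar alpha a ord0 j) (phibar alpha c ord0 j).
Proof.
move=> al ap cp; rewrite le_max; apply/orP.
case: (join_row_or a c j) => Ej; [left|right].
  have := phibar_le_scale hm al ap (join_row_gel a c) (lexx 1) (j := j).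
  by rewrite Ej !mul1r; apply.
have := phibar_le_scale hm al cp (join_row_ger a c) (lexx 1) (j := j).
by rewrite Ej !mul1r; apply.
Qed.

(** Raising a to the join with c moves only coordinates where c is larger, so
    every phibar_j is at most its common value at a and c, while the sum of the
    phibar_j has strictly increased. *)
Lemma phibar_inj (alpha : R) a c : 0 < alpha -> all_pos a -> all_pos c ->
  phibar alpha a = phibar alpha c -> a = c.
Proof.
move=> al; wlog [k ack] : a c / exists k, a ord0 k < c ord0 k.
  move=> W ap cp E.
  have [[k ack]|nac] := pselect (exists k, a ord0 k < c ord0 k).
    exact: (W a c (ex_intro _ k ack) ap cp E).
  have [[k cak]|nca] := pselect (exists k, c ord0 k < a ord0 k).
    exact/esym/(W c a (ex_intro _ k cak) cp ap (esym E)).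
  apply/rowP => k; apply/eqP; rewrite eq_le !leNgt; apply/andP; split.
    by apply/negP => h; apply: nca; exists k.
  by apply/negP => h; apply: nac; exists k.
move=> ap cp E; have al0 := ltW al.
have lt_sum : rowsum (phibar alpha a) < rowsum (phibar alpha (join_row a c)).
  apply: (rowsum_phibar_incr hm al0 al ap (join_row_gel a c)).
  exists k; exact: lt_le_trans ack (join_row_ger _ _ _).
have le_sum : rowsum (phibar alpha (join_row a c)) <= rowsum (phibar alpha a).
  apply: ler_sum => j _; have := phibar_join_le j al0 ap cp.
  by rewrite -E maxxx.
by move: lt_sum; rewrite ltNge le_sum.
Qed.

(** For alpha > 0 small parameters are subsolutions, by phibar_le_sqrt with
    P >= alpha, and subsolutions are bounded by rowsum_phibar_ge. *)
Lemma phibar_bij (alpha : R) : 0 < alpha ->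
  set_bij [set a : 'rV[R]_m | all_pos a]
    [set b : 'rV[R]_m |
       (forall j, 0 < b ord0 j < pi / 2) /\ rowsum b < pi / 2]
    (phibar alpha).
Proof.
move=> al; have al0 := ltW al; split.
- move=> a ap /=; have S := rowsum_phibar_lt hm al0 ap al.
  split=> // j; rewrite phibar_gt0//=.
  exact: le_lt_trans (phibar_lt_rowsum hm al0 ap j) S.
- move=> a c; rewrite !inE => ap cp; exact: phibar_inj.
- move=> b [bj bS].
  have p2 : 0 < pi / 2 :> R by rewrite divr_gt0 ?pi_gt0.
  pose K : R := (Num.sqrt alpha)^-1 * (pi / 2).
  have K0 : 0 < K by rewrite mulr_gt0 ?invr_gt0 ?sqrtr_gt0.
  pose a0 : 'rV[R]_m := \row_k (b ord0 k / K) ^+ 2.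
  have a0p : all_pos a0.
    by move=> k; rewrite mxE exprn_gt0// divr_gt0//; case/andP: (bj k).
  have a0b j : phibar alpha a0 ord0 j <= b ord0 j.
    apply: le_trans (phibar_le_sqrt hm al0 a0p j al _) _.
      by move=> t; apply: P_ge_alpha.
    have bj0 : 0 < b ord0 j by case/andP: (bj j).
    rewrite mxE sqrtr_sqr gtr0_norm ?divr_gt0// -mulrA -/K.
    by rewrite divfK// gt_eqF.
  (* On subsolutions D <= C / sqrt a_j, by rowsum_phibar_ge. *)
  pose D := pi / 2 - rowsum b.
  have D0 : 0 < D by rewrite subr_gt0.
  pose C := alpha / Num.sqrt (alpha / 2) * (pi / 2).
  have C0 : 0 < C by rewrite mulr_gt0// divr_gt0// sqrtr_gt0 divr_gt0.
  have [||||| a [ap _ aE]] := @monotone_system_solvable R m predT (phibar alpha) b a0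
    ((C / D) ^+ 2).
  + by move=> a c l j ap ac l1 cl; apply: phibar_le_scale.
  + by move=> a j ap; apply: phibar_gt0.
  + exact: a0p.
  + by move=> j _; apply: a0b.
  + move=> a ap _ ab j _.
    have DS : D <= pi / 2 - rowsum (phibar alpha a).
      by rewrite lerD2l lerN2; apply: ler_sum => k _; apply: ab.
    have := le_trans DS (rowsum_phibar_ge hm al0 ap j al).
    have s0 : 0 < Num.sqrt (a ord0 j) by rewrite sqrtr_gt0.
    have -> : alpha / (Num.sqrt (a ord0 j) * Num.sqrt (alpha / 2)) * (pi / 2) =
        C / Num.sqrt (a ord0 j).
      by rewrite /C invfM; ring.
    rewrite ler_pdivlMr// mulrC -ler_pdivlMr// => h.
    rewrite -[leLHS]sqr_sqrtr; last exact: ltW (ap j).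
    by rewrite lerXn2r// nnegrE ltW// divr_gt0.
  exists a => //; apply/rowP => j; exact: aE.
Qed.

(** For alpha = 0 the angles depend only on the ratios of the parameters: one
    parameter is set to 1 and the angles of the others are prescribed; the
    remaining angle is then correct because the sum is always pi/2. *)
Lemma phibar0_image :
  phibar 0 @` [set a : 'rV[R]_m | all_pos a] =
  [set b : 'rV[R]_m | (forall j, 0 < b ord0 j <= pi / 2) /\ rowsum b = pi / 2].
Proof.
have z0 : 0 <= 0 :> R by [].
apply/seteqP; split => [_ [a ap <-]|b [bj bS]].
  have S := rowsum_phibar_eq hm z0 ap erefl.
  split=> // j; rewrite phibar_gt0//= -S.
  exact: phibar_lt_rowsum.
pose i0 := Ordinal hm.
have p2 : 0 < pi / 2 :> R by rewrite divr_gt0 ?pi_gt0.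
have b0 j : 0 < b ord0 j by case/andP: (bj j).
pose a0 : 'rV[R]_m := \row_k (if k == i0 then 1 else (b ord0 k / (pi / 2)) ^+ 2).
have a0p : all_pos a0.
  by move=> k; rewrite mxE; case: ifP => // _; rewrite exprn_gt0// divr_gt0.
have a0i : a0 ord0 i0 = 1 by rewrite mxE eqxx.
have [||||| a [ap aJ aE]] := @monotone_system_solvable R m (predC1 i0) (phibar 0) b a0
    (((pi / 2) / b ord0 i0) ^+ 2).
- by move=> a c l j ap ac l1 cl; apply: phibar_le_scale.
- by move=> a j ap; apply: phibar_gt0.
- exact: a0p.
- move=> j ji; apply: le_trans (phibar_le_sqrt hm z0 a0p j ltr01 _) _.
    by move=> t; rewrite -a0i; apply: P_ge_coef.
  rewrite sqrtr1 divr1 mxE ifN// sqrtr_sqr gtr0_norm ?divr_gt0 ?pi_gt0//.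
  by rewrite divfK// gt_eqF.
- move=> a ap aJ ab j ji.
  have ai : a ord0 i0 = 1 by rewrite aJ ?a0i//= eqxx.
  have bi : b ord0 i0 <= phibar 0 a ord0 i0.
    have := rowsum_phibar_eq hm z0 ap erefl; rewrite -bS /rowsum.
    rewrite (bigD1 i0)//= [RHS](bigD1 i0)//= => E.
    rewrite -(lerD2r (\sum_(i < m | i != i0) b ord0 i)) -E lerD2l.
    by apply: ler_sum => k ki; apply: ab.
  have s0 : 0 < Num.sqrt (a ord0 j) by rewrite sqrtr_gt0.
  have := le_trans bi (phibar_le_sqrt hm z0 ap i0 (ap j) _).
  rewrite ai sqrtr1 => /(_ (fun t => P_ge_coef z0 j t ap)).
  rewrite mul1r mulrC ler_pdivlMr// mulrC -ler_pdivlMr// => h.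
  rewrite -[leLHS]sqr_sqrtr; last exact: ltW (ap j).
  by rewrite lerXn2r// nnegrE ltW// divr_gt0.
exists a => //; apply/rowP => j.
have [->|ji] := eqVneq j i0; last exact: aE.
have := rowsum_phibar_eq hm z0 ap erefl; rewrite -bS /rowsum.
rewrite (bigD1 i0)//= [RHS](bigD1 i0)//= => E.
apply: (addIr (\sum_(i < m | i != i0) b ord0 i)); rewrite -E; congr (_ + _).
by apply: eq_bigr => k ki; rewrite aE.
Qed.

End LimitAngleMap.

(** * Smooth maps into C^n *)

Section SmoothMaps.
Context {R : realType} {m : nat}.
Local Notation n := m.+1.
Implicit Types (f g : 'rV[R]_n -> R) (u v : 'rV[R]_n).

(** Polynomials in smooth functions of one coordinate; this class is large
    enough for the parametrizations below and stable under partial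
    derivatives. *)
Inductive smoothn : ('rV[R]_n -> R) -> Prop :=
| Smoothn_coord h i : smooth1 h -> smoothn (fun u => h (u ord0 i))
| Smoothn_add f g : smoothn f -> smoothn g -> smoothn (fun u => f u + g u)
| Smoothn_mul f g : smoothn f -> smoothn g -> smoothn (fun u => f u * g u).

Lemma is_derive_coord (h : R -> R) (dh : R) u v i :
  is_derive (u ord0 i) 1 h dh ->
  differentiable (fun u => h (u ord0 i)) u /\
  is_derive u v (fun u => h (u ord0 i)) (v ord0 i * dh).
Proof.
move=> hD.
have hd : differentiable h (u ord0 i).
  by apply/derivable1_diffP; case: hD.
have cd := @differentiable_coord R 1 n u ord0 i.
have d : differentiable (fun u => h (u ord0 i)) u.
  exact: (@differentiable_comp _ _ _ _ (fun u => u ord0 i) h).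
split=> //; apply: DeriveDef; first exact: diff_derivable.
rewrite deriveE// (@diff_comp _ _ _ _ (fun u => u ord0 i) h)//=.
rewrite -(deriveE v cd).
have -> : 'D_v (fun u => u ord0 i) u = v ord0 i.
  have := derive_mx (@derivable_id _ _ u v).
  by rewrite derive_id => /matrixP/(_ ord0 i); rewrite mxE => ->.
rewrite -[X in 'd _ _ X]mulr1 linearZ /= -deriveE//.
by rewrite (@derive_val _ _ _ _ _ _ _ hD).
Qed.

Lemma smoothn_differentiable f u : smoothn f -> differentiable f u.
Proof.
elim=> {f} [h i sh|f g _ IHf _ IHg|f g _ IHf _ IHg].
- have [dh _ hD] := smooth1_derive sh.
  by have [] := is_derive_coord u (hD (u ord0 i)).
- exact: (@differentiableD _ _ _ f g).
- exact: (@differentiableM _ _ f g).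
Qed.

Lemma smoothn_derive f v : smoothn f -> smoothn (fun u => 'D_v f u).
Proof.
elim=> {f} [h i sh|f g sf IHf sg IHg|f g sf IHf sg IHg].
- have [dh sdh hD] := smooth1_derive sh.
  have -> : (fun u => 'D_v (fun u => h (u ord0 i)) u) =
      (fun u => v ord0 i * dh (u ord0 i)).
    apply/funext => u; have [_ D] := is_derive_coord v (hD (u ord0 i)).
    by rewrite (@derive_val _ _ _ _ _ _ _ D).
  apply: (@Smoothn_coord (fun x => v ord0 i * dh x)).
  by apply: Smooth1_mul => //; exact: Smooth1_cst.
- have -> : (fun u => 'D_v (fun u => f u + g u) u) =
      (fun u => 'D_v f u + 'D_v g u).
    apply/funext => u; rewrite -deriveD//;
      exact/diff_derivable/smoothn_differentiable.
  exact: Smoothn_add.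
- have -> : (fun u => 'D_v (fun u => f u * g u) u) =
      (fun u => f u * 'D_v g u + g u * 'D_v f u).
    apply/funext => u; rewrite -deriveM//;
      exact/diff_derivable/smoothn_differentiable.
  by apply: Smoothn_add; apply: Smoothn_mul.
Qed.

Lemma smoothn_sum (I : Type) (r : seq I) (f : I -> 'rV[R]_n -> R) :
  (forall i, smoothn (f i)) -> smoothn (fun u => \sum_(i <- r) f i u).
Proof.
move=> sf; elim: r => [|i r IH].
  under eq_fun do rewrite big_nil.
  exact: (@Smoothn_coord (fun=> 0) ord0 (Smooth1_cst 0)).
under eq_fun do rewrite big_cons.
exact: Smoothn_add.
Qed.

Definition of_parts (f g : 'I_n -> 'rV[R]_n -> R) (u : 'rV[R]_n) : Cn R n :=
  of_zcoord (fun k => (f k u +i* g k u)%C).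

Lemma of_partsE (f g : 'I_n -> 'rV[R]_n -> R) u :
  of_parts f g u = (\row_k f k u, \row_k g k u).
Proof. by rewrite /of_parts /of_zcoord; congr (_, _); apply/rowP => k; rewrite !mxE. Qed.

Lemma differentiable_row (f : 'I_n -> 'rV[R]_n -> R) u :
  (forall k, differentiable (f k) u) ->
  differentiable (fun u => \row_k f k u) u.
Proof.
move=> fd.
have -> : (fun u => \row_k f k u) =
    \sum_(k < n) (fun u => f k u *: (delta_mx ord0 k : 'rV[R]_n)).
  apply/funext => w; apply/rowP => k; rewrite fct_sumE summxE mxE (bigD1 k)//=.
  rewrite !mxE !eqxx mulr1 big1 ?addr0// => i ik.
  by rewrite !mxE eqxx eq_sym (negbTE ik) mulr0.
by apply: differentiable_sum => k; apply: differentiableZl.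
Qed.

Lemma derive_row (f : 'I_n -> 'rV[R]_n -> R) u v :
  (forall k, differentiable (f k) u) ->
  'D_v (fun u => \row_k f k u) u = \row_k 'D_v (f k) u.
Proof.
move=> fd; rewrite derive_mx; last exact/diff_derivable/differentiable_row.
apply/rowP => k; rewrite !mxE; congr ('D_v _ u).
by apply/funext => w; rewrite mxE.
Qed.

Lemma differentiable_of_parts (f g : 'I_n -> 'rV[R]_n -> R) u :
  (forall k, differentiable (f k) u) -> (forall k, differentiable (g k) u) ->
  differentiable (of_parts f g) u.
Proof.
move=> fd gd.
have -> : of_parts f g = (fun u => (\row_k f k u, \row_k g k u)).
  by apply/funext => w; exact: of_partsE.
by apply: differentiable_pair; apply: differentiable_row.
Qed.

Lemma derive_of_parts (f g : 'I_n -> 'rV[R]_n -> R) u v :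
  (forall k, differentiable (f k) u) -> (forall k, differentiable (g k) u) ->
  'D_v (of_parts f g) u =
  of_parts (fun k u => 'D_v (f k) u) (fun k u => 'D_v (g k) u) u.
Proof.
move=> fd gd.
have fr := differentiable_row fd; have gr := differentiable_row gd.
have E : of_parts f g = (fun u => (\row_k f k u, \row_k g k u)).
  by apply/funext => w; exact: of_partsE.
rewrite E of_partsE (deriveE v (differentiable_pair fr gr)) (diff_pair fr gr) /=.
congr (_, _).
  exact: etrans (esym (deriveE v fr)) (derive_row v fd).
exact: etrans (esym (deriveE v gr)) (derive_row v gd).
Qed.

Lemma smooth_of_parts (f g : 'I_n -> 'rV[R]_n -> R) :
  (forall k, smoothn (f k)) -> (forall k, smoothn (g k)) ->
  smooth (of_parts f g).
Proof.
move=> sf sg k; elim: k f g sf sg => [|k IH] f g sf sg /=.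
  move=> u; apply: differentiable_continuous.
  by apply: differentiable_of_parts => i; exact: smoothn_differentiable.
split=> [u|j].
  by apply: differentiable_of_parts => i; exact: smoothn_differentiable.
have -> : partial j (of_parts f g) =
    of_parts (fun k => partial j (f k)) (fun k => partial j (g k)).
  apply/funext => u; rewrite /partial derive_of_parts// => i;
    exact: smoothn_differentiable.
by apply: IH => i; apply: smoothn_derive.
Qed.

End SmoothMaps.

(** * Proper embeddings *)

Section ProperEmbeddings.
Context {R : realType} {m : nat}.
Local Notation n := m.+1.
(** The continuous function B makes F proper: locally on the target, F may be
    restricted to a compact ball. *)
Variables (F : 'rV[R]_n -> Cn R n) (B : Cn R n -> R).
Hypotheses (cF : continuous F) (cB : continuous B)
  (FB : forall u, `|u| <= B (F u)).

Let K (r : R) : set 'rV[R]_n := [set u | `|u| <= r].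

Let compact_K r : compact (K r).
Proof.
apply: bounded_closed_compact.
  by exists r; split; [rewrite num_real|move=> M rM u /= ur; rewrite (le_trans ur)// ltW].
apply: (@preimage_closed _ _ (fun u : 'rV[R]_n => `|u|) [set x | x <= r]).
  by move=> u _; exact: norm_continuous.
exact: closed_le.
Qed.

Let closed_image (A : set 'rV[R]_n) r : closed A -> closed (F @` (A `&` K r)).
Proof.
move=> cA; apply: compact_closed; first exact: norm_hausdorff.
apply: continuous_compact; first exact: continuous_subspaceT.
by rewrite setIC; apply: compact_closedI => //; exact: compact_K.
Qed.

Let near_bound p : nbhs p [set q | B q < B p + 1].
Proof.
have h : nbhs (B p) [set x | x < B p + 1].
  by apply: open_nbhs_nbhs; split; [exact: open_lt|rewrite /= ltrDl].
exact: cB p _ h.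
Qed.

Lemma proper_closed_range : closed (range F).
Proof.
move=> p pF.
have : closure (F @` (setT `&` K (B p + 1))) p.
  move=> V Vp.
  have [_ [[u _ <-] [Vu Bu]]] := pF _ (filterI Vp (near_bound p)).
  exists (F u); split=> //; exists u => //; split=> //=.
  by rewrite /K /= (le_trans (FB u))// ltW.
move/(closed_image closedT) => [u _ <-].
by exists u.
Qed.

Lemma proper_inverse_continuous (G : Cn R n -> 'rV[R]_n) :
  cancel F G -> {within range F, continuous G}.
Proof.
move=> FG; apply/subspace_continuousP => _ [u _ <-] V.
have -> : from_subspace (range F) G (F u) = u by exact: FG.
move=> Vu.
have cV : closed (~` V°) by apply: open_closedC; exact: open_interior.
have W := near_bound (F u).
have oI := closed_openC (closed_image (r := B (F u) + 1) cV).
have I : nbhs (F u) (~` (F @` (~` V° `&` K (B (F u) + 1)))).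
  apply: open_nbhs_nbhs; split=> // -[w [wV _] wu]; apply: wV.
  by rewrite -(FG w) wu FG.
apply: (filterS _ (filterI I W)) => q [nI Bw] [w _ wE].
have Gw : from_subspace (range F) G q = w by rewrite -wE; exact: FG.
rewrite /preimage /= Gw.
apply: interior_subset; apply: contrapT => wV.
apply: nI; exists w => //; split=> //; rewrite /K /=.
by rewrite (le_trans (FB w))// wE ltW.
Qed.

End ProperEmbeddings.

(** * Linear algebra of Lagrangian frames *)

Section BorderedMatrices.
Context {K : fieldType} {m : nat}.

Lemma sum_lift_max (V : nmodType) (E : 'I_m.+1 -> V) :
  \sum_k E k = \sum_j E (lift ord_max j) + E ord_max.
Proof. by rewrite (bigD1_ord ord_max)//= addrC. Qed.

(** Elimination of the last row: the last pivot is the Schur complement of the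
    diagonal block. *)
Lemma det_bordered (A : 'M[K]_m.+1) (d : 'I_m -> K) :
  (forall j, d j != 0) ->
  (forall i j, A (lift ord_max i) (lift ord_max j) = d i *+ (i == j)) ->
  \det A = (\prod_j d j) * (A ord_max ord_max -
    \sum_j A ord_max (lift ord_max j) * A (lift ord_max j) ord_max / d j).
Proof.
move=> d0 dA; set z := A ord_max ord_max - _.
(* A = L U, with L unitriangular and U upper triangular. *)
pose L : 'M[K]_m.+1 := \matrix_(k, l)
  if unlift ord_max k is Some i then (k == l)%:R
  else if unlift ord_max l is Some j then A ord_max l / d j else 1.
pose U : 'M[K]_m.+1 := \matrix_(k, l)
  if unlift ord_max k is Some i then A k l
  else if unlift ord_max l is Some j then 0 else z.
have LU : A = L *m U.
  apply/matrixP => k l; rewrite mxE sum_lift_max.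
  case: (unliftP ord_max k) => [i ->|->].
    rewrite !mxE liftK unlift_none [_ == ord_max]eq_sym eq_liftF mul0r addr0.
    rewrite (bigD1 i)//= !mxE !liftK eqxx mul1r big1 ?addr0// => j ji.
    by rewrite !mxE !liftK (inj_eq lift_inj) eq_sym (negbTE ji) mul0r.
  rewrite !mxE !unlift_none mul1r.
  under eq_bigr do rewrite !mxE !unlift_none !liftK.
  case: (unliftP ord_max l) => [i ->|->].
    rewrite addr0 (bigD1 i)//= dA eqxx divfK ?d0// big1 ?addr0// => j ji.
    by rewrite dA (negbTE ji) mulr0.
  rewrite /z addrC -addrA [- _ + _]addrC -[LHS]addr0; congr (_ + _).
  rewrite -sumrB big1// => j _.
  by rewrite mulrAC subrr.
have det_L : \det L = 1.
  rewrite det_trig; last first.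
    apply/is_trig_mxP => k l kl; rewrite mxE.
    case: (unliftP ord_max k) => [i kE|kE]; first by rewrite lt_eqF.
    by move: kl; rewrite kE /= ltnNge -ltnS ltn_ord.
  apply: big1 => k _; rewrite mxE.
  by case: (unliftP ord_max k) => [i kE|kE]; rewrite ?eqxx.
have det_U : \det U = (\prod_j d j) * z.
  rewrite -det_tr det_trig; last first.
    apply/is_trig_mxP => k l kl; rewrite !mxE.
    case: (unliftP ord_max l) => [i lE|lE].
      case: (unliftP ord_max k) => [j kE|kE].
        rewrite lE kE dA; case: eqP => // ij.
        by move: kl; rewrite lE kE ij ltnn.
      by move: kl; rewrite kE /= ltnNge -ltnS ltn_ord.
    case: (unliftP ord_max k) => [j kE|kE] //.
    by move: kl; rewrite lE kE ltnn.
  rewrite (bigD1_ord ord_max)//= mulrC !mxE unlift_none; congr (_ * _).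
  by apply: eq_bigr => j _; rewrite !mxE liftK dA eqxx.
by rewrite LU det_mulmx det_L det_U mul1r.
Qed.

Lemma invmx_right n (A B : 'M[K]_n) : A *m B = 1%:M -> invmx A = B.
Proof.
move=> AB; have [uA _] := mulmx1_unit AB.
by rewrite -[LHS]mulmx1 -AB mulmxA mulVmx// mul1mx.
Qed.

End BorderedMatrices.

Lemma sum_complex (R : rcfType) (I : Type) (r : seq I) (f g : I -> R) :
  \sum_(i <- r) (f i +i* g i)%C =
  ((\sum_(i <- r) f i) +i* (\sum_(i <- r) g i))%C.
Proof.
elim: r => [|i r IH]; first by rewrite !big_nil.
by rewrite !big_cons IH; simpc.
Qed.

Section LagrangianFrames.
Context {R : realType} {m : nat}.
Local Notation n := m.+1.
Implicit Types (F : 'rV[R]_n -> Cn R n) (u : 'rV[R]_n) (v w : Cn R n).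

Lemma edotDl v1 v2 w : edot (v1 + v2) w = edot v1 w + edot v2 w.
Proof. by rewrite -big_split /=; apply: eq_bigr => i _; rewrite !mxE; ring. Qed.

Lemma edotZl (c : R) v w : edot (c *: v) w = c * edot v w.
Proof. by rewrite mulr_sumr; apply: eq_bigr => i _; rewrite !mxE; ring. Qed.

Lemma edot0l w : edot 0 w = 0.
Proof. by rewrite [LHS]big1// => i _; rewrite !mxE !mul0r addr0. Qed.

Lemma normal_partD F u v w :
  normal_part F u (v + w) = normal_part F u v + normal_part F u w.
Proof.
rewrite /normal_part addrACA -opprD -big_split /=; congr (_ - _).
apply: eq_bigr => i _; rewrite -big_split /=; apply: eq_bigr => j _.
by rewrite edotDl mulrDr scalerDl.
Qed.

Lemma normal_partZ F u (c : R) w :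
  normal_part F u (c *: w) = c *: normal_part F u w.
Proof.
rewrite /normal_part scalerBr; congr (_ - _).
rewrite scaler_sumr; apply: eq_bigr => i _.
rewrite scaler_sumr; apply: eq_bigr => j _.
by rewrite edotZl scalerA; congr (_ *: _); ring.
Qed.

Lemma normal_part0 F u : normal_part F u 0 = 0.
Proof. by have := normal_partZ F u 0 0; rewrite !scale0r. Qed.

Lemma normal_part_sum (I : Type) (r : seq I) F u (w : I -> Cn R n) :
  normal_part F u (\sum_(i <- r) w i) = \sum_(i <- r) normal_part F u (w i).
Proof. exact: (big_morph (normal_part F u) (normal_partD F u) (normal_part0 F u)). Qed.

Lemma normal_part_partial F u k : metric F u \in unitmx ->
  normal_part F u (partial k F u) = 0.
Proof.
move=> gu; rewrite /normal_part exchange_big /=.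
have E j : \sum_i (invmx (metric F u) i j *
      edot (partial k F u) (partial i F u)) *: partial j F u =
    (k == j)%:R *: partial j F u.
  rewrite -scaler_suml; congr (_ *: _).
  have /matrixP/(_ k j) := mulmxV gu; rewrite !mxE => <-.
  by apply: eq_bigr => i _; rewrite mxE mulrC.
under eq_bigr do rewrite E.
rewrite (bigD1 k)//= eqxx scale1r big1 ?addr0 ?subrr// => j jk.
by rewrite eq_sym (negbTE jk) scale0r.
Qed.

Lemma normal_part_add_tangent F u w (c : 'I_m -> R) (d : R) :
  metric F u \in unitmx ->
  normal_part F u (w + (\sum_j c j *: partial (lift ord_max j : 'I_n) F u +
                        d *: partial (ord_max : 'I_n) F u)) = normal_part F u w.
Proof.
move=> gu; have N0 k := normal_part_partial k gu.
rewrite normal_partD normal_partD normal_partZ N0 scaler0 addr0.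
rewrite normal_part_sum big1 ?addr0// => j _.
by rewrite normal_partZ N0 scaler0.
Qed.

Lemma mean_curvature_trace F u : mean_curvature F u = normal_part F u
  (\sum_k \sum_l invmx (metric F u) k l *: partial k (partial l F) u).
Proof.
rewrite normal_part_sum; apply: eq_bigr => k _.
by rewrite normal_part_sum; apply: eq_bigr => l _; rewrite normal_partZ.
Qed.

(** The matrix Z of the frame has conj(Z)^T Z = g + i omega, so that on a
    Lagrangian the volume density is the modulus of dz_1 ... dz_n. *)
Lemma det_metric_dz F u :
  (forall i j, omega (partial i F u) (partial j F u) = 0) ->
  (\det (metric F u))%:C%C = (dz_frame F u)^*%C * dz_frame F u.
Proof.
move=> w0; rewrite /dz_frame; set Z := \matrix_(_, _) _.
have -> : (\det Z)^*%C = \det (map_mx conjc Z)^T by rewrite det_tr det_map_mx.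
rewrite -det_mulmx -(det_map_mx (real_complex R)); congr (\det _).
apply/matrixP => i j; rewrite !mxE.
have E k : (map_mx conjc Z)^T i k * Z k j =
   (((partial i F u).1 ord0 k * (partial j F u).1 ord0 k +
     (partial i F u).2 ord0 k * (partial j F u).2 ord0 k) +i*
    ((partial i F u).1 ord0 k * (partial j F u).2 ord0 k -
     (partial i F u).2 ord0 k * (partial j F u).1 ord0 k))%C.
  by rewrite !mxE /zcoord /=; simpc; congr (_ +i* _)%C; ring.
under eq_bigr do rewrite E.
by rewrite sum_complex; congr (_ +i* _)%C; rewrite -[LHS](w0 i j).
Qed.

Lemma dz_frame_angle F u (t rho : R) : 0 <= rho ->
  (forall i j, omega (partial i F u) (partial j F u) = 0) ->
  dz_frame F u = expi t * rho%:C%C ->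
  dz_frame F u = expi t * (Num.sqrt (\det (metric F u)))%:C%C.
Proof.
move=> rho0 w0 E; rewrite E; congr (_ * _%:C%C).
have := det_metric_dz w0; rewrite E /expi; simpc => -[+ _].
have -> : cos t * rho * (cos t * rho) + sin t * rho * (sin t * rho) =
    rho ^+ 2 * (cos t ^+ 2 + sin t ^+ 2) by ring.
rewrite cos2Dsin2 mulr1 => ->.
by rewrite sqrtr_sqr ger0_norm.
Qed.

End LagrangianFrames.

(** * The parametrization *)

Section SplitPoints.
Context {R : realType} {m : nat}.
Implicit Types (A B : 'I_m -> R) (z w : R).

(** The point (A_1 + i B_1, ..., A_m + i B_m, z + i w). *)
Definition split_point A B z w : Cn R m.+1 :=
  of_zcoord (fun k => if unlift ord_max k is Some j then (A j +i* B j)%C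
                      else (z +i* w)%C).

Lemma split_pointD A B z w A' B' z' w' :
  split_point A B z w + split_point A' B' z' w' =
  split_point (fun j => A j + A' j) (fun j => B j + B' j) (z + z') (w + w').
Proof.
by congr (_, _); apply/rowP => k; rewrite !mxE; case: unlift.
Qed.

Lemma split_pointZ (c : R) A B z w :
  c *: split_point A B z w =
  split_point (fun j => c * A j) (fun j => c * B j) (c * z) (c * w).
Proof.
by congr (_, _); apply/rowP => k; rewrite !mxE; case: unlift.
Qed.

Lemma eq_split_point A B z w A' B' z' w' :
  A =1 A' -> B =1 B' -> z = z' -> w = w' ->
  split_point A B z w = split_point A' B' z' w'.
Proof. by move=> /funext-> /funext-> -> ->. Qed.

Lemma split_point0 : split_point (fun=> 0) (fun=> 0) 0 0 = 0.
Proof. by congr (_, _); apply/rowP => k; rewrite !mxE; case: unlift. Qed.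

Lemma split_point_sum (I : Type) (r : seq I) (A B : I -> 'I_m -> R)
    (z w : I -> R) :
  \sum_(i <- r) split_point (A i) (B i) (z i) (w i) =
  split_point (fun j => \sum_(i <- r) A i j) (fun j => \sum_(i <- r) B i j)
    (\sum_(i <- r) z i) (\sum_(i <- r) w i).
Proof.
elim: r => [|i r IH].
  rewrite big_nil -split_point0; apply: eq_split_point => [j|j||];
    by rewrite big_nil.
rewrite big_cons IH split_pointD; apply: eq_split_point => [j|j||];
  by rewrite big_cons.
Qed.

Lemma split_point_lift A B z w j :
  ((split_point A B z w).1 ord0 (lift ord_max j) = A j) *
  ((split_point A B z w).2 ord0 (lift ord_max j) = B j).
Proof. by rewrite !mxE liftK. Qed.

Lemma split_point_max A B z w :
  ((split_point A B z w).1 ord0 ord_max = z) *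
  ((split_point A B z w).2 ord0 ord_max = w).
Proof. by rewrite !mxE unlift_none. Qed.

Lemma edot_split A B z w A' B' z' w' :
  edot (split_point A B z w) (split_point A' B' z' w') =
  \sum_j (A j * A' j + B j * B' j) + (z * z' + w * w').
Proof.
rewrite /edot sum_lift_max !split_point_max; congr (_ + _).
by apply: eq_bigr => j _; rewrite !split_point_lift.
Qed.

Lemma omega_split A B z w A' B' z' w' :
  omega (split_point A B z w) (split_point A' B' z' w') =
  \sum_j (A j * B' j - B j * A' j) + (z * w' - w * z').
Proof.
rewrite /omega sum_lift_max !split_point_max; congr (_ + _).
by apply: eq_bigr => j _; rewrite !split_point_lift.
Qed.

Lemma split_point_of_parts (A B : 'I_m -> 'rV[R]_m.+1 -> R)
    (z w : 'rV[R]_m.+1 -> R) :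
  (fun u => split_point (A^~ u) (B^~ u) (z u) (w u)) =
  of_parts (fun k => if unlift ord_max k is Some j then A j else z)
           (fun k => if unlift ord_max k is Some j then B j else w).
Proof.
apply/funext => u; rewrite of_partsE; congr (_, _); apply/rowP => k;
  by rewrite !mxE; case: unlift.
Qed.

Lemma smooth_split (A B : 'I_m -> 'rV[R]_m.+1 -> R) (z w : 'rV[R]_m.+1 -> R) :
  (forall j, smoothn (A j)) -> (forall j, smoothn (B j)) -> smoothn z ->
  smoothn w -> smooth (fun u => split_point (A^~ u) (B^~ u) (z u) (w u)).
Proof.
move=> sA sB sz sw; rewrite split_point_of_parts.
by apply: smooth_of_parts => k; case: unlift.
Qed.

Lemma derive_split (A B : 'I_m -> 'rV[R]_m.+1 -> R) (z w : 'rV[R]_m.+1 -> R)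
    u v (dA dB : 'I_m -> R) (dz dw : R) :
  (forall j, smoothn (A j)) -> (forall j, smoothn (B j)) -> smoothn z ->
  smoothn w ->
  (forall j, is_derive u v (A j) (dA j)) ->
  (forall j, is_derive u v (B j) (dB j)) ->
  is_derive u v z dz -> is_derive u v w dw ->
  'D_v (fun u => split_point (A^~ u) (B^~ u) (z u) (w u)) u =
  split_point dA dB dz dw.
Proof.
move=> sA sB sz sw AD BD zD wD; rewrite split_point_of_parts derive_of_parts.
- rewrite of_partsE; congr (_, _); apply/rowP => k; rewrite !mxE;
    case: unlift => [j|]; exact: derive_val.
- by move=> k; case: unlift => [j|]; apply: smoothn_differentiable.
- by move=> k; case: unlift => [j|]; apply: smoothn_differentiable.
Qed.

End SplitPoints.

Lemma trace_block (R : pzRingType) (m : nat) (V : lmodType R) (h : 'M[R]_m.+1)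
    (D : 'I_m.+1 -> 'I_m.+1 -> V) :
  (forall i, h (lift ord_max i) ord_max = 0) ->
  (forall i, h ord_max (lift ord_max i) = 0) ->
  (forall i j, i != j -> D (lift ord_max i) (lift ord_max j) = 0) ->
  \sum_k \sum_l h k l *: D k l =
  \sum_i h (lift ord_max i) (lift ord_max i) *:
    D (lift ord_max i) (lift ord_max i) + h ord_max ord_max *: D ord_max ord_max.
Proof.
move=> hxy hyx D0; rewrite sum_lift_max; congr (_ + _).
  apply: eq_bigr => i _; rewrite sum_lift_max hxy scale0r addr0 (bigD1 i)//=.
  by rewrite big1 ?addr0// => j ji; rewrite D0 ?scaler0// eq_sym.
rewrite sum_lift_max big1 ?add0r// => j _.
by rewrite hyx scale0r.
Qed.

Lemma norm_le1D (R : realDomainType) (x c : R) : x ^+ 2 <= c -> `|x| <= 1 + c.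
Proof.
move=> xc; apply: le_trans (_ : 1 + x ^+ 2 <= _); last by rewrite lerD2l.
by rewrite -(real_normK (num_real x)); move: (`|x|) => t; nra.
Qed.

(** The map F of this section is
    (x, y) |-> (x_j r_j(y) e^(i phi_j(y)), y^2/2 - |x|^2/2 + i (psi(y) + c0)),
    where r_j^2 - y^2 is constant, psi' = p and phi_j' = p / r_j^2. The function b
    bounds 1 / r_j^2, and angleD is the derivative of the relation
    phi_1 + ... + phi_m + alpha psi = atan (y / p), q being p'. *)
Section Parametrization.
Context {R : realType} {m : nat}.
Local Notation n := m.+1.
Variables (r phi : 'I_m -> R -> R) (psi p q : R -> R) (c0 alpha : R).
Variable b : 'I_m -> R.
Hypotheses (r_gt0 : forall j y, 0 < r j y) (p_gt0 : forall y, 0 < p y).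
Hypotheses (sr : forall j, smooth1 (r j)) (sphi : forall j, smooth1 (phi j))
  (spsi : smooth1 psi) (sp : smooth1 p).
Hypotheses (rD : forall j (y : R), is_derive y 1 (r j) (y / r j y))
  (phiD : forall j (y : R), is_derive y 1 (phi j) (p y / r j y ^+ 2))
  (psiD : forall y : R, is_derive y 1 psi (p y))
  (pD : forall y : R, is_derive y 1 p (q y)).
Hypothesis angleD : forall y,
  p y - y * q y =
  (y ^+ 2 + p y ^+ 2) * (p y * (\sum_j (r j y ^+ 2)^-1 + alpha)).
Hypotheses (b0 : forall j, 0 <= b j) (br : forall j y, 1 <= b j * r j y ^+ 2).
Implicit Types u v w : 'rV[R]_n.

Let X u (j : 'I_m) : R := u ord0 (lift ord_max j : 'I_n).
Let Y u : R := u ord0 (ord_max : 'I_n).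

(* Real and imaginary parts of w = r_j e^(i phi_j) and of its first two
   derivatives, which are zeta e^(i phi_j) / r_j, for zeta = y + i p, and
   (zeta' / r_j - |zeta|^2 / r_j^3) e^(i phi_j). *)
Let re0 j y := r j y * cos (phi j y).
Let im0 j y := r j y * sin (phi j y).
Let re1 j y := (y * cos (phi j y) - p y * sin (phi j y)) / r j y.
Let im1 j y := (y * sin (phi j y) + p y * cos (phi j y)) / r j y.
Let k2 j y := (r j y)^-1 - (y ^+ 2 + p y ^+ 2) / r j y ^+ 3.
Let re2 j y := k2 j y * cos (phi j y) - q y / r j y * sin (phi j y).
Let im2 j y := k2 j y * sin (phi j y) + q y / r j y * cos (phi j y).

Let cosD j (y : R) : is_derive y 1 (fun y => cos (phi j y))
  (- sin (phi j y) * (p y / r j y ^+ 2)).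
Proof. exact: is_derive_comp (is_derive_cos _) (phiD j y). Qed.

Let sinD j (y : R) : is_derive y 1 (fun y => sin (phi j y))
  (cos (phi j y) * (p y / r j y ^+ 2)).
Proof. exact: is_derive_comp (is_derive_sin _) (phiD j y). Qed.

Let rinvD j (y : R) :
  is_derive y 1 (fun y => (r j y)^-1) (- (y / r j y) * (r j y)^-1 ^+ 2).
Proof. by apply: is_deriveV1 (rD j y); rewrite gt_eqF. Qed.

Let re0D j (y : R) : is_derive y 1 (re0 j) (re1 j y).
Proof.
apply: (is_derive_eq (is_deriveM1 (rD j y) (cosD j y))).
by rewrite /re1; field; rewrite gt_eqF.
Qed.

Let im0D j (y : R) : is_derive y 1 (im0 j) (im1 j y).
Proof.
apply: (is_derive_eq (is_deriveM1 (rD j y) (sinD j y))).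
by rewrite /im1; field; rewrite gt_eqF.
Qed.

Let re1D j (y : R) : is_derive y 1 (re1 j) (re2 j y).
Proof.
have d1 := is_deriveM1 (is_derive_id y 1) (cosD j y).
have d2 := is_deriveM1 (is_derive_cst (-1 : R) y 1) (is_deriveM1 (pD y) (sinD j y)).
have d3 := is_deriveM1 (is_deriveD1 d1 d2) (rinvD j y).
have -> : re1 j = fun y => (id y * cos (phi j y) +
   cst (-1) y * (p y * sin (phi j y))) * (r j y)^-1.
  by apply/funext => z; rewrite /re1 /cst mulN1r.
apply: (is_derive_eq d3).
by rewrite /re2 /k2 /cst; field; rewrite gt_eqF.
Qed.

Let im1D j (y : R) : is_derive y 1 (im1 j) (im2 j y).
Proof.
have d1 := is_deriveM1 (is_derive_id y 1) (sinD j y).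
have d2 := is_deriveM1 (pD y) (cosD j y).
have d3 := is_deriveM1 (is_deriveD1 d1 d2) (rinvD j y).
apply: (is_derive_eq d3).
by rewrite /im2 /k2; field; rewrite gt_eqF.
Qed.

Let scos j : smooth1 (fun y => cos (phi j y)).
Proof. exact: (Smooth1_comp Smooth1_cos (sphi j)). Qed.

Let ssin j : smooth1 (fun y => sin (phi j y)).
Proof. exact: (Smooth1_comp Smooth1_sin (sphi j)). Qed.

Let srinv j : smooth1 (fun y => (r j y)^-1).
Proof. by apply: Smooth1_inv => // y; rewrite gt_eqF. Qed.

Let sre0 j : smooth1 (re0 j). Proof. exact: Smooth1_mul. Qed.
Let sim0 j : smooth1 (im0 j). Proof. exact: Smooth1_mul. Qed.

Let sre1 j : smooth1 (re1 j).
Proof.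
have -> : re1 j = fun y => (id y * cos (phi j y) +
   cst (-1) y * (p y * sin (phi j y))) * (r j y)^-1.
  by apply/funext => z; rewrite /re1 /cst mulN1r.
apply: Smooth1_mul => //; apply: Smooth1_add; apply: Smooth1_mul => //.
- exact: smooth1_id.
- exact: Smooth1_cst.
- exact: Smooth1_mul.
Qed.

Let sim1 j : smooth1 (im1 j).
Proof.
apply: Smooth1_mul => //; apply: Smooth1_add; apply: Smooth1_mul => //.
exact: smooth1_id.
Qed.

Definition soliton_map u : Cn R n :=
  split_point (fun j => X u j * re0 j (Y u)) (fun j => X u j * im0 j (Y u))
    (Y u ^+ 2 / 2 - (\sum_j X u j ^+ 2) / 2) (psi (Y u) + c0).

Local Notation F := soliton_map.

Let smoothX j : smoothn (fun u => X u j).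
Proof. exact: (@Smoothn_coord _ _ id _ smooth1_id). Qed.

Let smoothY (h : R -> R) : smooth1 h -> smoothn (fun u => h (Y u)).
Proof. exact: Smoothn_coord. Qed.

Let smooth_cst (c : R) : smoothn (fun _ : 'rV[R]_n => c).
Proof. exact: (@Smoothn_coord _ _ (fun=> c) ord0 (Smooth1_cst c)). Qed.

Let smoothXY j (h : R -> R) : smooth1 h -> smoothn (fun u => X u j * h (Y u)).
Proof. by move=> sh; apply: Smoothn_mul => //; exact: smoothY. Qed.

Let derX j u v : is_derive u v (fun u => X u j) (X v j).
Proof.
have [_ D] := is_derive_coord v (is_derive_id (X u j) 1).
by apply: is_derive_eq D _; rewrite mulr1.
Qed.

Let derY (h : R -> R) (dh : R) u v : is_derive (Y u) 1 h dh ->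
  is_derive u v (fun u => h (Y u)) (Y v * dh).
Proof. by move=> hD; have [_ D] := is_derive_coord v hD. Qed.

Let derXY j (h : R -> R) (dh : R) u v : is_derive (Y u) 1 h dh ->
  is_derive u v (fun u => X u j * h (Y u)) (X v j * h (Y u) + Y v * (X u j * dh)).
Proof.
move=> hD; have D := is_deriveM (derX j u v) (derY v hD).
by apply: (is_derive_eq D); rewrite /GRing.scale /=; ring.
Qed.

Let smooth_last : smoothn (fun u => Y u ^+ 2 / 2 - (\sum_j X u j ^+ 2) / 2).
Proof.
have -> : (fun u => Y u ^+ 2 / 2 - (\sum_j X u j ^+ 2) / 2) =
  (fun u => Y u ^+ 2 * (2^-1) + (\sum_j X u j * X u j) * (- 2^-1)).
  by apply/funext => u; rewrite mulrN.
apply: Smoothn_add; apply: Smoothn_mul => //.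
  exact: smoothY smooth1_sqr.
by apply: smoothn_sum => j; apply: Smoothn_mul.
Qed.

Lemma soliton_map_smooth : smooth F.
Proof.
apply: smooth_split => [j|j||].
- exact: smoothXY.
- exact: smoothXY.
- exact: smooth_last.
- by apply: Smoothn_add => //; exact: smoothY.
Qed.

Lemma derive_soliton_map u v : 'D_v F u =
  split_point (fun j => X v j * re0 j (Y u) + Y v * (X u j * re1 j (Y u)))
    (fun j => X v j * im0 j (Y u) + Y v * (X u j * im1 j (Y u)))
    (Y v * Y u - \sum_j X u j * X v j) (Y v * p (Y u)).
Proof.
apply: derive_split => [j|j|||j|j||].
- exact: smoothXY.
- exact: smoothXY.
- exact: smooth_last.
- by apply: Smoothn_add => //; exact: smoothY.
- exact: derXY.
- exact: derXY.
- have d2 : is_derive (Y u) 1 (fun y : R => y ^+ 2 / 2) (Y u).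
    have d := is_deriveM1 (is_derive_id (Y u) 1) (is_derive_id (Y u) 1).
    apply: (is_derive_eq (is_deriveM1 d (is_derive_cst (2^-1 : R) (Y u) 1))).
    by rewrite /cst; field.
  have dX : is_derive u v (fun u => (\sum_j X u j ^+ 2) / 2)
      (\sum_j X u j * X v j).
    have d j : is_derive u v (fun u => X u j * X u j) (2 * (X u j * X v j)).
      apply: (is_derive_eq (is_deriveM (derX j u v) (derX j u v))).
      by rewrite /GRing.scale /=; ring.
    have D := is_deriveM (is_derive_sum d) (is_derive_cst (2^-1 : R) u v).
    have E : (fun u => (\sum_j X u j ^+ 2) / 2) =
       (\sum_(j < m) (fun u => X u j * X u j)) * cst 2^-1.
      by apply/funext => z; rewrite !fctE fct_sumE.
    rewrite E; apply: (is_derive_eq D).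
    by rewrite -mulr_sumr /GRing.scale /= /cst; field.
  by apply: is_deriveB => //; exact: derY.
- have D := is_deriveD (derY v (psiD (Y u))) (is_derive_cst c0 u v).
  by apply: (is_derive_eq D); rewrite addr0.
Qed.

Lemma derive2_soliton_map u v w : 'D_w (fun u => 'D_v F u) u =
  split_point
    (fun j => (X v j * Y w + X w j * Y v) * re1 j (Y u) +
       Y v * Y w * (X u j * re2 j (Y u)))
    (fun j => (X v j * Y w + X w j * Y v) * im1 j (Y u) +
       Y v * Y w * (X u j * im2 j (Y u)))
    (Y v * Y w - \sum_j X v j * X w j) (Y v * Y w * q (Y u)).
Proof.
have -> : (fun u => 'D_v F u) = fun u =>
  split_point (fun j => X v j * re0 j (Y u) + Y v * (X u j * re1 j (Y u)))
    (fun j => X v j * im0 j (Y u) + Y v * (X u j * im1 j (Y u)))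
    (Y v * Y u + \sum_j X u j * (- X v j)) (Y v * p (Y u)).
  apply/funext => z; rewrite derive_soliton_map; congr split_point.
  by rewrite -sumrN; congr (_ + _); apply: eq_bigr => j _; rewrite mulrN.
have sc j (g h : R -> R) : smooth1 g -> smooth1 h ->
    smoothn (fun u => X v j * g (Y u) + Y v * (X u j * h (Y u))).
  move=> sg sh; apply: Smoothn_add; apply: Smoothn_mul => //.
    exact: smoothY.
  exact: smoothXY.
have dc j (g h : R -> R) (dg dh : R) : is_derive (Y u) 1 g dg ->
    is_derive (Y u) 1 h dh -> dg = h (Y u) -> is_derive u w
    (fun u => X v j * g (Y u) + Y v * (X u j * h (Y u)))
    ((X v j * Y w + X w j * Y v) * h (Y u) + Y v * Y w * (X u j * dh)).
  move=> gD hD gh.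
  have D1 := is_deriveM (is_derive_cst (X v j) u w) (derY w gD).
  have D2 := is_deriveM (is_derive_cst (Y v) u w) (derXY j w hD).
  apply: (is_derive_eq (is_deriveD D1 D2)).
  by rewrite /GRing.scale /= /cst gh; ring.
apply: derive_split => [j|j|||j|j||].
- exact: sc.
- exact: sc.
- apply: Smoothn_add; first by apply: Smoothn_mul => //; exact: smoothY smooth1_id.
  by apply: smoothn_sum => j; apply: Smoothn_mul.
- by apply: Smoothn_mul => //; exact: smoothY.
- exact: (dc _ _ _ _ _ (re0D j _) (re1D j _)).
- exact: (dc _ _ _ _ _ (im0D j _) (im1D j _)).
- have D1 := is_deriveM (is_derive_cst (Y v) u w) (derY w (is_derive_id (Y u) 1)).
  have d j : is_derive u w (fun u => X u j * (- X v j)) (- (X v j * X w j)).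
    apply: (is_derive_eq (is_deriveM (derX j u w) (is_derive_cst (- X v j) u w))).
    by rewrite /GRing.scale /= /cst; ring.
  have D := is_deriveD D1 (is_derive_sum d).
  have -> : (fun u => Y v * Y u + \sum_j X u j * (- X v j)) =
      (cst (Y v) * (fun u => id (Y u))) +
      \sum_(j < m) (fun u => X u j * (- X v j)).
    by apply/funext => z; rewrite !fctE fct_sumE.
  apply: (is_derive_eq D).
  by rewrite sumrN /GRing.scale /= /cst; ring.
- have D := is_deriveM (is_derive_cst (Y v) u w) (derY w (pD (Y u))).
  by apply: (is_derive_eq D); rewrite /GRing.scale /= /cst; ring.
Qed.

Let cs1 j y : cos (phi j y) ^+ 2 + sin (phi j y) ^+ 2 = 1.
Proof. exact: cos2Dsin2. Qed.

(* The inner products and the determinant of w and w'. *)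
Let nrm0 j y : re0 j y ^+ 2 + im0 j y ^+ 2 = r j y ^+ 2.
Proof. by rewrite -[RHS]mulr1 -(cs1 j y) /re0 /im0; ring. Qed.

Let dot01 j y : re0 j y * re1 j y + im0 j y * im1 j y = y.
Proof.
rewrite -[RHS]mulr1 -(cs1 j y) /re0 /im0 /re1 /im1.
by field; rewrite gt_eqF.
Qed.

Let wedge01 j y : re0 j y * im1 j y - im0 j y * re1 j y = p y.
Proof.
rewrite -[RHS]mulr1 -(cs1 j y) /re0 /im0 /re1 /im1.
by field; rewrite gt_eqF.
Qed.

Let nrm1 j y : re1 j y ^+ 2 + im1 j y ^+ 2 = (y ^+ 2 + p y ^+ 2) / r j y ^+ 2.
Proof.
rewrite -[RHS]mulr1 -(cs1 j y) /re1 /im1.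
by field; rewrite gt_eqF.
Qed.

(** The j-th and the last coordinate contribute x_j p and - x_j p to
    omega (d_j F, d_y F). *)
Lemma soliton_map_lagrangian u v w : omega ('D_v F u) ('D_w F u) = 0.
Proof.
rewrite !derive_soliton_map omega_split; set y := Y u.
have E j : (X v j * re0 j y + Y v * (X u j * re1 j y)) *
      (X w j * im0 j y + Y w * (X u j * im1 j y)) -
    (X v j * im0 j y + Y v * (X u j * im1 j y)) *
      (X w j * re0 j y + Y w * (X u j * re1 j y)) =
    Y w * p y * (X u j * X v j) - Y v * p y * (X u j * X w j).
  by rewrite -(wedge01 j y); ring.
under eq_bigr do rewrite E.
by rewrite sumrB -!mulr_sumr; ring.
Qed.

Let W u := 1 + \sum_j X u j ^+ 2 / r j (Y u) ^+ 2.

Let W_gt0 u : 0 < W u.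
Proof.
rewrite ltr_pwDl// sumr_ge0// => j _.
by rewrite divr_ge0 ?sqr_ge0.
Qed.

Let Z2 u := Y u ^+ 2 + p (Y u) ^+ 2.

Let Z2_gt0 u : 0 < Z2 u.
Proof. by rewrite ltr_wpDl ?sqr_ge0// exprn_gt0. Qed.

(** The y direction is orthogonal to the x directions: <w_j, w_j'> = y, so the
    first coordinates and the last one contribute x_j y and - x_j y. *)
Lemma edot_derive_soliton_map u v w : edot ('D_v F u) ('D_w F u) =
  \sum_j r j (Y u) ^+ 2 * (X v j * X w j) +
  (\sum_j X u j * X v j) * (\sum_j X u j * X w j) + Y v * Y w * (Z2 u * W u).
Proof.
rewrite !derive_soliton_map edot_split /Z2; set y := Y u.
have E j : (X v j * re0 j y + Y v * (X u j * re1 j y)) *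
      (X w j * re0 j y + Y w * (X u j * re1 j y)) +
    (X v j * im0 j y + Y v * (X u j * im1 j y)) *
      (X w j * im0 j y + Y w * (X u j * im1 j y)) =
    r j y ^+ 2 * (X v j * X w j) + (Y w * y * (X u j * X v j) +
     (Y v * y * (X u j * X w j) +
      Y v * Y w * (y ^+ 2 + p y ^+ 2) * (X u j ^+ 2 / r j y ^+ 2))).
  transitivity ((re0 j y ^+ 2 + im0 j y ^+ 2) * (X v j * X w j) +
    ((re0 j y * re1 j y + im0 j y * im1 j y) * (Y w * (X u j * X v j)) +
    ((re0 j y * re1 j y + im0 j y * im1 j y) * (Y v * (X u j * X w j)) +
     (re1 j y ^+ 2 + im1 j y ^+ 2) * (Y v * Y w * X u j ^+ 2)))); first by ring.
  by rewrite nrm0 dot01 nrm1; ring.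
under eq_bigr do rewrite E.
rewrite !big_split /= -!mulr_sumr /W -/y.
by ring.
Qed.

Let ex (i : 'I_m) : 'rV[R]_n := delta_mx ord0 (lift ord_max i : 'I_n).
Let ey : 'rV[R]_n := delta_mx ord0 (ord_max : 'I_n).

Let coord_ex i j : X (ex i) j = (i == j)%:R.
Proof. by rewrite /X /ex mxE eqxx /= (inj_eq lift_inj) eq_sym. Qed.

Let coordY_ex i : Y (ex i) = 0.
Proof. by rewrite /Y /ex mxE eqxx /= eq_liftF. Qed.

Let coord_ey j : X ey j = 0.
Proof. by rewrite /X /ey mxE eqxx /= eq_sym eq_liftF. Qed.

Let coordY_ey : Y ey = 1.
Proof. by rewrite /Y /ey mxE !eqxx. Qed.

Let sum_ex (E : 'I_m -> R) i : \sum_j E j * X (ex i) j = E i.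
Proof.
rewrite (bigD1 i)//= coord_ex eqxx mulr1 big1 ?addr0// => j ji.
by rewrite coord_ex eq_sym (negbTE ji) mulr0.
Qed.

Let sum_ey (E : 'I_m -> R) : \sum_j E j * X ey j = 0.
Proof. by rewrite big1// => j _; rewrite coord_ey mulr0. Qed.

Let metric_xx u i j :
  metric F u (lift ord_max i : 'I_n) (lift ord_max j : 'I_n) =
  r i (Y u) ^+ 2 * (i == j)%:R + X u i * X u j.
Proof.
rewrite mxE edot_derive_soliton_map !sum_ex !coordY_ex !mul0r addr0.
congr (_ + _); under eq_bigr do rewrite mulrA.
by rewrite sum_ex coord_ex; case: eqP => [->|]; rewrite ?mulr0.
Qed.

Let metric_xy u i :
  metric F u (lift ord_max i : 'I_n) (ord_max : 'I_n) = 0.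
Proof.
rewrite mxE edot_derive_soliton_map !sum_ex !sum_ey !coordY_ex !mul0r mulr0 !addr0.
by under eq_bigr do rewrite mulrA; rewrite sum_ey.
Qed.

Let metric_yx u i :
  metric F u (ord_max : 'I_n) (lift ord_max i : 'I_n) = 0.
Proof.
rewrite mxE edot_derive_soliton_map !sum_ex !sum_ey !coordY_ex mulr0 !mul0r !addr0.
by rewrite big1// => j _; rewrite coord_ey mul0r mulr0.
Qed.

Let metric_yy u : metric F u (ord_max : 'I_n) (ord_max : 'I_n) = Z2 u * W u.
Proof.
rewrite mxE edot_derive_soliton_map !sum_ey !coordY_ey mulr0 addr0 !mul1r.
by rewrite big1 ?add0r// => j _; rewrite coord_ey !mulr0.
Qed.

(** The inverse of a diagonal matrix plus x^T x, by the Sherman-Morrison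
    formula, completed by the decoupled y direction. *)
Let cometric u : 'M[R]_n := \matrix_(k, l)
  match unlift ord_max k, unlift ord_max l with
  | Some i, Some j => (i == j)%:R / r i (Y u) ^+ 2 -
      X u i * X u j / (r i (Y u) ^+ 2 * r j (Y u) ^+ 2 * W u)
  | None, None => (Z2 u * W u)^-1
  | _, _ => 0
  end.

Let cometric_xx u i j :
  cometric u (lift ord_max i : 'I_n) (lift ord_max j : 'I_n) =
  (i == j)%:R / r i (Y u) ^+ 2 -
      X u i * X u j / (r i (Y u) ^+ 2 * r j (Y u) ^+ 2 * W u).
Proof. by rewrite mxE !liftK. Qed.

Let cometric_xy u i : cometric u (lift ord_max i : 'I_n) (ord_max : 'I_n) = 0.
Proof. by rewrite mxE liftK unlift_none. Qed.

Let cometric_yx u i : cometric u (ord_max : 'I_n) (lift ord_max i : 'I_n) = 0.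
Proof. by rewrite mxE liftK unlift_none. Qed.

Let cometric_yy u :
  cometric u (ord_max : 'I_n) (ord_max : 'I_n) = (Z2 u * W u)^-1.
Proof. by rewrite mxE unlift_none. Qed.

Let metric_cometric u : metric F u *m cometric u = 1%:M.
Proof.
apply/matrixP => k l; rewrite [LHS]mxE sum_lift_max [RHS]mxE.
have W0 := W_gt0 u; have Z0 := Z2_gt0 u.
case: (unliftP ord_max k) => [i ->|->]; case: (unliftP ord_max l) => [j ->|->].
- rewrite metric_xy mul0r addr0 (inj_eq lift_inj); set y := Y u.
  have E s : metric F u (lift ord_max i : 'I_n) (lift ord_max s : 'I_n) *
      cometric u (lift ord_max s : 'I_n) (lift ord_max j : 'I_n) =
    (r i y ^+ 2 * cometric u (lift ord_max s : 'I_n) (lift ord_max j : 'I_n)) *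
      X (ex i) s +
    (X u i * (X u s / r s y ^+ 2) * X (ex j) s -
     (X u i * X u j / (r j y ^+ 2 * W u)) * (X u s ^+ 2 / r s y ^+ 2)).
    rewrite metric_xx cometric_xx !coord_ex [j == s]eq_sym -/y.
    by field; rewrite !gt_eqF// r_gt0.
  under eq_bigr do rewrite E.
  rewrite big_split /= sum_ex sumrB sum_ex -mulr_sumr cometric_xx -/y.
  have -> : \sum_(s < m) X u s ^+ 2 / r s y ^+ 2 = W u - 1.
    by rewrite /W addrC addKr.
  by field; rewrite !gt_eqF// r_gt0.
- rewrite metric_xy mul0r addr0 big1 => [|s _].
    by rewrite eq_sym eq_liftF.
  by rewrite cometric_xy mulr0.
- rewrite cometric_yx mulr0 addr0 big1 => [|s _].
    by rewrite eq_liftF.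
  by rewrite metric_yx mul0r.
- rewrite eqxx metric_yy cometric_yy divff; last first.
    by apply: mulf_neq0; rewrite gt_eqF.
  by rewrite big1 ?add0r// => s _; rewrite metric_yx mul0r.
Qed.

Let invmx_metric u : invmx (metric F u) = cometric u.
Proof. exact/invmx_right/metric_cometric. Qed.

Let metric_unit u : metric F u \in unitmx.
Proof. by have [] := mulmx1_unit (metric_cometric u). Qed.

Lemma soliton_map_immersion u v : 'D_v F u = 0 -> v = 0.
Proof.
move=> v0.
have := edot_derive_soliton_map u v v; rewrite v0 edot0l => /esym/eqP.
have sge : 0 <= \sum_j r j (Y u) ^+ 2 * (X v j * X v j).
  by apply: sumr_ge0 => j _; rewrite mulr_ge0 ?sqr_ge0// -expr2 sqr_ge0.
rewrite paddr_eq0; last 2 first.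
- by rewrite addr_ge0// -expr2 sqr_ge0.
- by rewrite -expr2 mulr_ge0 ?sqr_ge0// mulr_ge0 ?ltW.
rewrite paddr_eq0 ?sge -?expr2 ?sqr_ge0// => /andP[/andP[s0 _] y0].
have Yv : Y v = 0.
  move: y0; rewrite mulf_eq0 [_ * W _ == 0]mulf_eq0.
  by rewrite (gt_eqF (Z2_gt0 u)) (gt_eqF (W_gt0 u)) !orbF sqrf_eq0 => /eqP.
have Xv j : X v j = 0.
  move: s0; rewrite psumr_eq0 => [/allP/(_ j)|i _]; last first.
    by rewrite mulr_ge0 ?sqr_ge0// -expr2 sqr_ge0.
  rewrite mem_index_enum => /(_ isT) /implyP/(_ isT).
  by rewrite mulf_eq0 sqrf_eq0 gt_eqF//= -expr2 sqrf_eq0 => /eqP.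
apply/rowP => k; rewrite [RHS]mxE.
by case: (unliftP ord_max k) => [j ->|->]; [exact: Xv|exact: Yv].
Qed.
(** The trace of the second derivatives differs from T by a tangent vector; its
    coefficient on the y direction is read off the imaginary part of the last
    coordinate, those on the x directions off the first coordinates, and
    the real part of the last coordinate is then the derivative of the
    Lagrangian angle. *)
Lemma soliton_map_translating u :
  mean_curvature F u = normal_part F u (split_point (fun=> 0) (fun=> 0) alpha 0).
Proof.
set y := Y u; set T := split_point _ _ _ _.
have W0 := W_gt0 u; have Z0 := Z2_gt0 u; have py := p_gt0 y.
(* The trace of the second derivatives is T + sum_j kx_j d_j F + ky d_y F. *)
pose hyy := (Z2 u * W u)^-1.
pose ky := hyy * q y / p y.
pose kx j := X u j * hyy *
  ((1 - y * q y / p y) / r j y ^+ 2 - Z2 u / r j y ^+ 4).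
pose tr := \sum_j cometric u (lift ord_max j : 'I_n) (lift ord_max j : 'I_n).
have d2xx i j : partial (lift ord_max i : 'I_n) (partial (lift ord_max j : 'I_n) F) u =
    (i == j)%:R *: split_point (fun=> 0) (fun=> 0) (- 1) 0.
  rewrite /partial derive2_soliton_map split_pointZ; apply: eq_split_point.
  - by move=> s; rewrite !coordY_ex; ring.
  - by move=> s; rewrite !coordY_ex; ring.
  - by rewrite sum_ex !coordY_ex coord_ex eq_sym; ring.
  - by rewrite !coordY_ex; ring.
have d2yy : partial (ord_max : 'I_n) (partial (ord_max : 'I_n) F) u =
    split_point (fun j => X u j * re2 j y) (fun j => X u j * im2 j y) 1 (q y).
  rewrite /partial derive2_soliton_map; apply: eq_split_point.
  - by move=> s; rewrite !coordY_ey coord_ey; ring.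
  - by move=> s; rewrite !coordY_ey coord_ey; ring.
  - by rewrite sum_ey !coordY_ey; ring.
  - by rewrite !coordY_ey; ring.
have d1x i : partial (lift ord_max i : 'I_n) F u =
    split_point (fun j => (i == j)%:R * re0 j y) (fun j => (i == j)%:R * im0 j y)
      (- X u i) 0.
  rewrite /partial derive_soliton_map; apply: eq_split_point.
  - by move=> s; rewrite coordY_ex coord_ex; ring.
  - by move=> s; rewrite coordY_ex coord_ex; ring.
  - by rewrite sum_ex coordY_ex; ring.
  - by rewrite coordY_ex; ring.
have d1y : partial (ord_max : 'I_n) F u =
    split_point (fun j => X u j * re1 j y) (fun j => X u j * im1 j y) y (p y).
  rewrite /partial derive_soliton_map; apply: eq_split_point.
  - by move=> s; rewrite coordY_ey coord_ey; ring.
  - by move=> s; rewrite coordY_ey coord_ey; ring.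
  - by rewrite sum_ey coordY_ey subr0 mul1r.
  - by rewrite coordY_ey mul1r.
have trace : \sum_k \sum_l cometric u k l *: partial k (partial l F) u =
    split_point (fun j => hyy * (X u j * re2 j y))
      (fun j => hyy * (X u j * im2 j y)) (hyy - tr) (hyy * q y).
  transitivity (tr *: split_point (fun=> 0) (fun=> 0) (- 1) 0 + hyy *:
      split_point (fun j => X u j * re2 j y) (fun j => X u j * im2 j y) 1 (q y)).
    have D0 i j : i != j ->
        partial (lift ord_max i : 'I_n) (partial (lift ord_max j : 'I_n) F) u = 0.
      by move=> ij; rewrite d2xx (negbTE ij) scale0r.
    apply: etrans (@trace_block _ _ _ (cometric u)
      (fun k l => partial k (partial l F) u) (cometric_xy u) (cometric_yx u) D0) _.
    congr (_ + _); last by congr (_ *: _); [exact: cometric_yy|exact: d2yy].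
    apply: etrans (esym (scaler_suml _ _ _ _)); apply: eq_bigr => i _.
    by congr (_ *: _); apply: etrans (d2xx i i) _; rewrite eqxx scale1r.
  by rewrite !split_pointZ split_pointD; apply: eq_split_point => [j|j||]; ring.
have tangent : \sum_k \sum_l cometric u k l *: partial k (partial l F) u =
    T + (\sum_j kx j *: partial (lift ord_max j : 'I_n) F u +
         ky *: partial (ord_max : 'I_n) F u).
  rewrite trace d1y; under eq_bigr do rewrite d1x split_pointZ.
  rewrite split_point_sum split_pointZ !split_pointD.
  have sx (E : 'I_m -> R) (j : 'I_m) : \sum_i kx i * ((i == j)%:R * E j) = kx j * E j.
    rewrite (bigD1 j)//= eqxx mul1r big1 ?addr0// => i ij.
    by rewrite (negbTE ij) mul0r mulr0.
  apply: eq_split_point => [j|j||].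
  - rewrite (sx (fun j => re0 j y)) /kx /ky /re2 /re1 /re0 /k2 -/(Z2 u).
    by field; rewrite !gt_eqF// r_gt0.
  - rewrite (sx (fun j => im0 j y)) /kx /ky /im2 /im1 /im0 /k2 -/(Z2 u).
    by field; rewrite !gt_eqF// r_gt0.
  - pose S1 := \sum_j (r j y ^+ 2)^-1.
    pose S4 := \sum_j X u j ^+ 2 / r j y ^+ 4.
    have trE : tr = S1 - S4 / W u.
      rewrite /tr /S1 /S4 mulr_suml -sumrB; apply: eq_bigr => j _.
      rewrite cometric_xx eqxx mulr1n -/y.
      by field; rewrite !gt_eqF// r_gt0.
    have kE : \sum_i kx i * - X u i =
        - hyy * ((1 - y * q y / p y) * (W u - 1) - Z2 u * S4).
      have -> : W u - 1 = \sum_j X u j ^+ 2 / r j y ^+ 2 by rewrite /W addrC addKr.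
      rewrite /S4 !mulr_sumr -sumrB mulr_sumr.
      apply: eq_bigr => j _; rewrite /kx -/y.
      by field; rewrite !gt_eqF// r_gt0.
    have ang : 1 - y * q y / p y = Z2 u * (S1 + alpha).
      have pn : p y != 0 by rewrite gt_eqF.
      apply: (mulfI pn).
      have -> : p y * (1 - y * q y / p y) = p y - y * q y by field.
      by rewrite angleD mulrCA.
    rewrite trE kE ang /hyy /ky /hyy.
    have qE : q y * y / p y = 1 - Z2 u * (S1 + alpha).
      by rewrite -ang [q y * y]mulrC; ring.
    have -> : (Z2 u * W u)^-1 * q y / p y * y =
      (Z2 u * W u)^-1 * (q y * y / p y) by ring.
    by rewrite qE; field; rewrite !gt_eqF.
  - rewrite big1 => [|j _]; last by rewrite mulr0.
    by rewrite /ky; field; rewrite gt_eqF.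
apply: etrans (mean_curvature_trace F u) _; rewrite invmx_metric.
apply: etrans (congr1 (normal_part F u) tangent) _.
exact: normal_part_add_tangent.
Qed.

(** The Schur complement of the diagonal block diag (r_j e^(i phi_j)) is
    (y + i p)(1 + sum_j x_j^2 / r_j^2). *)
Lemma soliton_map_dz u : dz_frame F u =
  ((\prod_j ((r j (Y u))%:C * expi (phi j (Y u)))) *
   ((Y u +i* p (Y u)) * (W u)%:C))%C.
Proof.
set y := Y u.
pose d j : R[i] := ((r j y)%:C * expi (phi j y))%C.
have dE j : d j = (re0 j y +i* im0 j y)%C by rewrite /d /expi; simpc.
have d0 j : d j != 0.
  rewrite dE eq_complex /=; apply/negP => /andP[/eqP h1 /eqP h2].
  have := nrm0 j y; rewrite h1 h2 expr0n /= addr0 => /esym/eqP.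
  by rewrite sqrf_eq0 gt_eqF.
rewrite /dz_frame; set M := \matrix_(_, _) _.
have Myy : M ord_max ord_max = (y +i* p y)%C.
  rewrite mxE /zcoord /partial derive_soliton_map !split_point_max.
  by rewrite sum_ey coordY_ey subr0 !mul1r.
have Myx j : M ord_max (lift ord_max j : 'I_n) = (- X u j)%:C%C.
  rewrite mxE /zcoord /partial derive_soliton_map !split_point_max.
  by rewrite sum_ex coordY_ex !mul0r sub0r.
have Mxy j : M (lift ord_max j : 'I_n) ord_max =
    ((y +i* p y) * d j * (X u j / r j y ^+ 2)%:C)%C.
  rewrite mxE /zcoord /partial derive_soliton_map !split_point_lift.
  rewrite coordY_ey coord_ey dE /re0 /im0 /re1 /im1 -/y; simpc.
  by congr (_ +i* _)%C; field; rewrite gt_eqF.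
have Mxx i j : M (lift ord_max i : 'I_n) (lift ord_max j : 'I_n) = d i *+ (i == j).
  rewrite mxE /zcoord /partial derive_soliton_map !split_point_lift coordY_ex.
  rewrite coord_ex !mul0r !addr0 -/y eq_sym.
  by case: eqP => [->|_]; rewrite ?mulr1n ?mulr0n ?dE ?mul1r ?mul0r.
rewrite (det_bordered d0 Mxx) Myy; congr (_ * _).
have E j : M ord_max (lift ord_max j : 'I_n) * M (lift ord_max j : 'I_n) ord_max / d j =
    - ((y +i* p y)%C * (X u j ^+ 2 / r j y ^+ 2)%:C%C).
  rewrite Myx Mxy; set z := (y +i* p y)%C.
  have -> : (X u j ^+ 2 / r j y ^+ 2)%:C%C =
      (X u j)%:C%C * (X u j / r j y ^+ 2)%:C%C :> R[i].
    by rewrite -rmorphM /= mulrA -expr2.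
  have cancel_d (K : fieldType) (e f g h : K) :
      h != 0 -> - e * (f * h * g) / h = - (f * (e * g)) by move=> h0; field.
  by rewrite rmorphN /=; apply: cancel_d.
under eq_bigr do rewrite E.
rewrite sumrN opprK -mulr_sumr -rmorph_sum /= -{1}[(y +i* p y)%C]mulr1.
by rewrite -mulrDr; congr (_ * _); rewrite /W rmorphD /= rmorph1.
Qed.

Lemma soliton_map_inj : injective F.
Proof.
move=> u v uv.
have lastE : psi (Y u) + c0 = psi (Y v) + c0.
  have := congr1 (fun w : Cn R n => w.2 ord0 (ord_max : 'I_n)) uv.
  by rewrite /F !split_point_max.
have psi_incr : {homo psi : x z / x < z}.
  by move=> x z xz; apply: (is_derive_incr psiD xz) => s _; exact: p_gt0.
have YE : Y u = Y v.
  have h := addIr _ lastE.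
  have [lt|lt|//] := ltgtP (Y u) (Y v).
    by have := psi_incr _ _ lt; rewrite h ltxx.
  by have := psi_incr _ _ lt; rewrite h ltxx.
have XE j : X u j = X v j.
  have h1 := congr1 (fun w : Cn R n => w.1 ord0 (lift ord_max j : 'I_n)) uv.
  have h2 := congr1 (fun w : Cn R n => w.2 ord0 (lift ord_max j : 'I_n)) uv.
  move: h1 h2; rewrite /F !split_point_lift YE => h1 h2.
  have : (X u j - X v j) ^+ 2 * r j (Y v) ^+ 2 = 0.
    rewrite -nrm0.
    have -> : (X u j - X v j) ^+ 2 * (re0 j (Y v) ^+ 2 + im0 j (Y v) ^+ 2) =
       (X u j * re0 j (Y v) - X v j * re0 j (Y v)) ^+ 2 +
       (X u j * im0 j (Y v) - X v j * im0 j (Y v)) ^+ 2 by ring.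
    by rewrite h1 h2 !subrr expr0n /= addr0.
  move/eqP; rewrite mulf_eq0 !sqrf_eq0 [r _ _ == 0]gt_eqF// orbF subr_eq0.
  by move/eqP.
apply/rowP => k.
by case: (unliftP ord_max k) => [j ->|->]; [exact: XE|exact: YE].
Qed.

(* For w = F(x, y), x_j^2 <= b_j |w_j|^2 and y^2 = 2 Re w_n + |x|^2. *)
Let bound (w : Cn R n) : R := 1 + 2 * `|w.1 ord0 (ord_max : 'I_n)| +
  \sum_j b j * (w.1 ord0 (lift ord_max j : 'I_n) ^+ 2 +
                w.2 ord0 (lift ord_max j : 'I_n) ^+ 2).

Let bound_continuous : continuous bound.
Proof.
have c1 k : continuous (fun w : Cn R n => w.1 ord0 k).
  move=> w; apply: (@continuous_comp _ _ _ fst (fun v : 'rV[R]_n => v ord0 k)).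
    exact: cvg_fst.
  exact: coord_continuous.
have c2 k : continuous (fun w : Cn R n => w.2 ord0 k).
  move=> w; apply: (@continuous_comp _ _ _ snd (fun v : 'rV[R]_n => v ord0 k)).
    exact: cvg_snd.
  exact: coord_continuous.
move=> w; apply: cvgD.
  apply: cvgD; first exact: cvg_cst.
  apply: cvgM; first exact: cvg_cst.
  apply: (@cvg_norm _ _ _ _ _ (fun w : Cn R n => w.1 ord0 (ord_max : 'I_n))).
  exact: c1.
apply: cvg_big; first exact: add_continuous.
move=> j _; apply: cvgM; first exact: cvg_cst.
by apply: cvgD; apply: cvgM; (exact: c1 || exact: c2).
Qed.

Let le_bound u : `|u| <= bound (F u).
Proof.
have bX j : X u j ^+ 2 <= b j * ((F u).1 ord0 (lift ord_max j : 'I_n) ^+ 2 +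
    (F u).2 ord0 (lift ord_max j : 'I_n) ^+ 2).
  rewrite /F !split_point_lift.
  have -> : (X u j * re0 j (Y u)) ^+ 2 + (X u j * im0 j (Y u)) ^+ 2 =
      X u j ^+ 2 * r j (Y u) ^+ 2 by rewrite -nrm0; ring.
  by rewrite mulrCA ler_peMr ?sqr_ge0.
have S0 : 0 <= \sum_j b j * ((F u).1 ord0 (lift ord_max j : 'I_n) ^+ 2 +
    (F u).2 ord0 (lift ord_max j : 'I_n) ^+ 2).
  by apply: sumr_ge0 => j _; rewrite mulr_ge0// addr_ge0 ?sqr_ge0.
have B1 : bound (F u) = 1 + (2 * `|(F u).1 ord0 (ord_max : 'I_n)| +
  \sum_j b j * ((F u).1 ord0 (lift ord_max j : 'I_n) ^+ 2 +
                (F u).2 ord0 (lift ord_max j : 'I_n) ^+ 2)) by rewrite addrA.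
rewrite [leLHS]/Num.Def.normr /= mx_normrE.
apply: bigmax_le => [|[i k] _ /=].
  by rewrite B1 addr_ge0// addr_ge0// mulr_ge0.
rewrite (ord1 i) B1; apply: norm_le1D.
case: (unliftP ord_max k) => [j ->|->].
  apply: le_trans (bX j) _; rewrite (bigD1 j)//= addrCA lerDl addr_ge0//.
  by apply: sumr_ge0 => s _; rewrite mulr_ge0// addr_ge0 ?sqr_ge0.
rewrite -/(Y u).
have -> : Y u ^+ 2 = 2 * (F u).1 ord0 (ord_max : 'I_n) + \sum_j X u j ^+ 2.
  by rewrite /F !split_point_max; field.
by rewrite lerD ?ler_sum// ler_pM2l// ler_norm.
Qed.

Let F_continuous : continuous F.
Proof. exact: (soliton_map_smooth 0). Qed.

Lemma soliton_map_closed : closed (range F).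
Proof. exact: proper_closed_range F_continuous bound_continuous le_bound. Qed.

Lemma soliton_map_embedding : smooth_embedding F.
Proof.
split; [exact: soliton_map_smooth|exact: soliton_map_immersion|].
pose G (w : Cn R n) : 'rV[R]_n := xget 0 [set u | F u = w].
have FG : cancel F G.
  move=> u; rewrite /G; apply: soliton_map_inj.
  by case: xgetP => [v _ Pv|/(_ u)/(_ erefl)//]; exact: Pv.
exists G; split=> //.
exact: (proper_inverse_continuous F_continuous bound_continuous le_bound FG).
Qed.
End Parametrization.

(** * The solitons *)

Section SolitonParametrization.
Context {R : realType} {m : nat} (hm : (0 < m)%N).
Variables (alpha : R) (a : 'rV[R]_m).
Hypotheses (alpha0 : 0 <= alpha) (ap : all_pos a).
Local Notation n := m.+1.
Local Notation P := (P alpha a).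
Local Notation phi := (phi alpha a).
Local Notation psi := (psi alpha a).

Let r (j : 'I_m) (y : R) := Num.sqrt ((a ord0 j)^-1 + y ^+ 2).
Let p (y : R) := (Num.sqrt (P y))^-1.
Let q (y : R) := 'D_1 p y.

Let r_gt0 j y : 0 < r j y. Proof. by rewrite sqrtr_gt0 radius2_gt0. Qed.

Let p_gt0 y : 0 < p y. Proof. by rewrite invr_gt0 sqrtP_gt0. Qed.

Let r2 j y : r j y ^+ 2 = (a ord0 j)^-1 + y ^+ 2.
Proof. by rewrite sqr_sqrtr// ltW// radius2_gt0. Qed.

Let sr j : smooth1 (r j).
Proof. by apply: Smooth1_sqrt; [exact: smooth1_radius2|exact: radius2_gt0]. Qed.

Let rD j (y : R) : is_derive y 1 (r j) (y / r j y).
Proof.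
have d : is_derive y 1 (fun y : R => (a ord0 j)^-1 + y ^+ 2) (2 * y).
  have d2 := is_deriveM1 (is_derive_id y 1) (is_derive_id y 1).
  apply: (is_derive_eq (is_deriveD1 (is_derive_cst (a ord0 j)^-1 y 1) d2)).
  by rewrite add0r mulr1 mul1r mulr2n mulrDl mul1r.
have ds := @is_derive_sqrt1 R (fun y => (a ord0 j)^-1 + y ^+ 2) _ y
  (radius2_gt0 ap j y) d.
have -> : r j = fun y => Num.sqrt ((a ord0 j)^-1 + y ^+ 2) by [].
apply: (is_derive_eq ds).
by rewrite -/(r j y); field; rewrite gt_eqF// r_gt0.
Qed.

Let phiD j (y : R) : is_derive y 1 (phi j) (p y / r j y ^+ 2).
Proof.
apply: (is_derive_eq (is_derive_phi hm alpha0 ap j y)).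
by rewrite r2 invfM mulrC.
Qed.

Let psiD (y : R) : is_derive y 1 psi (p y). Proof. exact: is_derive_psi. Qed.

Let sp : smooth1 p. Proof. exact: smooth1_dpsi. Qed.

Let pD (y : R) : is_derive y 1 p (q y).
Proof.
have [dp _ D] := smooth1_derive sp.
by apply: derivableP; case: (D y).
Qed.

Let sphi j : smooth1 (phi j). Proof. exact: smooth1_phi. Qed.

Let spsi : smooth1 psi. Proof. exact: smooth1_psi. Qed.

(** The derivative of the relation between the phi_j, psi and atan(y / p). *)
Let angleD y : p y - y * q y =
  (y ^+ 2 + p y ^+ 2) * (p y * (\sum_j (r j y ^+ 2)^-1 + alpha)).
Proof.
have p0 := p_gt0 y.
have D1 : is_derive y 1 (fun y => \sum_j phi j y + alpha * psi y)
    (\sum_j (p y / r j y ^+ 2) + alpha * p y).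
  apply: is_deriveD1.
    have := @is_derive_sum _ _ _ m phi y 1 _ (phiD^~ y).
    by rewrite fct_sumE.
  have d := is_deriveM1 (is_derive_cst alpha y 1) (psiD y).
  by apply: (is_derive_eq d); rewrite mul0r add0r.
have E : (fun y => \sum_j phi j y + alpha * psi y) =
    (fun y => atan (y * (p y)^-1)).
  by apply/funext => z; rewrite (sum_phi hm alpha0 ap) /p invrK.
rewrite E in D1.
have pn : p y != 0 by rewrite gt_eqF.
have D2 := is_derive_comp (is_derive1_atan _)
  (is_deriveM1 (is_derive_id y 1) (is_deriveV1 pn (pD y))).
have := @derive_val _ _ _ _ _ _ _ D1; rewrite (@derive_val _ _ _ _ _ _ _ D2).
have -> : \sum_j (p y / r j y ^+ 2) + alpha * p y =
    p y * (\sum_j (r j y ^+ 2)^-1 + alpha).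
  by rewrite -mulr_sumr; ring.
move=> <-; field; rewrite pn /=.
by rewrite gt_eqF// ltr_pwDl ?sqr_ge0// exprn_gt0.
Qed.

Let br j y : 1 <= a ord0 j * r j y ^+ 2.
Proof.
rewrite r2 mulrDr divff ?gt_eqF// lerDl.
by rewrite mulr_ge0 ?sqr_ge0// ltW.
Qed.

Let a_ge0 j : 0 <= a ord0 j. Proof. exact/ltW/ap. Qed.

Definition soliton_param (c0 : R) : 'rV[R]_n -> Cn R n :=
  soliton_map r phi psi c0.

Lemma soliton_param_closed c0 : closed (range (soliton_param c0)).
Proof. exact: (soliton_map_closed sr sphi spsi a_ge0 br). Qed.

Lemma soliton_param_parametrizes c0 :
  parametrizes (soliton_param c0) (range (soliton_param c0)).
Proof.
split=> //; exact: (soliton_map_embedding c0 r_gt0 p_gt0 sr sphi spsi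
  rD phiD psiD a_ge0 br).
Qed.

Lemma soliton_param_lagrangian c0 u v w :
  omega ('D_v (soliton_param c0) u) ('D_w (soliton_param c0) u) = 0.
Proof. exact: (soliton_map_lagrangian c0 r_gt0 sr sphi spsi rD phiD psiD). Qed.

Lemma soliton_param_translating c0 u :
  mean_curvature (soliton_param c0) u =
  normal_part (soliton_param c0) u (translating_vector alpha).
Proof.
have -> : translating_vector alpha =
    split_point (fun=> 0) (fun=> 0) alpha 0 :> Cn R n.
  rewrite /translating_vector /split_point; congr of_zcoord.
  apply/funext => k; case: (unliftP ord_max k) => [j ->|->].
    by rewrite eq_sym eq_liftF.
  by rewrite eqxx.
exact: (soliton_map_translating c0 r_gt0 p_gt0 sr sphi spsi sp rD phiD psiD pD
  angleD).
Qed.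

Lemma expiD (s t : R) : expi (s + t) = expi s * expi t.
Proof. by rewrite /expi cosD sinD; simpc; congr (_ +i* _)%C; ring. Qed.

Lemma expi0 : expi (0 : R) = 1.
Proof. by rewrite /expi cos0 sin0. Qed.

Lemma expi_sum (f : 'I_m -> R) : expi (\sum_j f j) = \prod_j expi (f j).
Proof. exact: (big_morph expi expiD expi0). Qed.

(** The factors of dz_1 ... dz_n have arguments phi_j and arg (y + i p), which
    add up to pi / 2 - alpha psi. *)
Lemma soliton_param_angle c0 u : dz_frame (soliton_param c0) u =
  expi (pi / 2 - alpha * psi (u ord0 ord_max)) *
  (Num.sqrt (\det (metric (soliton_param c0) u)))%:C%C.
Proof.
set y := u ord0 ord_max.
have [_ yE] := arg_upper y (p_gt0 y).
pose W := 1 + \sum_j u ord0 (lift ord_max j) ^+ 2 / r j y ^+ 2.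
have W0 : 0 <= W.
  by rewrite addr_ge0// sumr_ge0// => j _; rewrite divr_ge0 ?sqr_ge0.
pose rho := (\prod_j r j y) * (Num.sqrt (y ^+ 2 + p y ^+ 2) * W).
apply: (@dz_frame_angle _ _ _ _ _ rho).
- rewrite mulr_ge0 ?mulr_ge0 ?sqrtr_ge0// prodr_ge0// => j _.
  by rewrite ltW.
- by move=> i j; exact: soliton_param_lagrangian.
apply: etrans (soliton_map_dz c0 r_gt0 sr sphi spsi rD phiD psiD u) _.
rewrite -/y big_split /= -(angle_psi hm alpha0 ap) expiD expi_sum.
rewrite -/(p y); set t := Defs.arg _; rewrite yE -/t -/W /rho !rmorphM /= rmorph_prod /=.
set A := \prod_j _%:C%C; set B := \prod_j expi _; ring.
Qed.

Definition last_coord (w : Cn R n) : R := w.2 ord0 ord_max.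

Lemma last_coord_continuous : continuous last_coord.
Proof.
move=> w; apply: (@continuous_comp _ _ _ snd (fun v : 'rV[R]_n => v ord0 ord_max)).
  exact: cvg_snd.
exact: coord_continuous.
Qed.

Lemma last_coord_param c0 u :
  last_coord (soliton_param c0 u) = psi (u ord0 ord_max) + c0.
Proof. by rewrite /last_coord split_point_max. Qed.

Lemma soliton_pointE x y z w : soliton_point alpha a x y (z +i* w)%C =
  split_point (fun j => x ord0 j * (r j y * cos (phi j y)))
    (fun j => x ord0 j * (r j y * sin (phi j y))) z w.
Proof.
rewrite /soliton_point /split_point; congr of_zcoord; apply/funext => k.
case: unlift => [j|] //.
by rewrite /expi; simpc; rewrite !mulrA.
Qed.

Lemma range_soliton_param c0 : range (soliton_param c0) =
  [set w | exists (x : 'rV[R]_m) (y : R), w = soliton_point alpha a x y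
    ((y ^+ 2 / 2 - (\sum_j x ord0 j ^+ 2) / 2) +i* (psi y + c0))%C].
Proof.
apply/seteqP; split => [_ [u _ <-]|_ [x [y ->]]].
  exists (\row_j u ord0 (lift ord_max j)), (u ord0 ord_max).
  rewrite soliton_pointE /soliton_param /soliton_map.
  apply: eq_split_point => // [j|j|]; rewrite ?mxE//.
  by congr (_ - _ / 2); apply: eq_bigr => j _; rewrite mxE.
pose u : 'rV[R]_n := \row_k if unlift ord_max k is Some j then x ord0 j else y.
have ux j : u ord0 (lift ord_max j : 'I_n) = x ord0 j by rewrite mxE liftK.
have uy : u ord0 (ord_max : 'I_n) = y by rewrite mxE unlift_none.
exists u => //; rewrite soliton_pointE /soliton_param /soliton_map !uy.
apply: eq_split_point => // [j|j|]; rewrite ?ux//.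
by congr (_ - _ / 2); apply: eq_bigr => j _; rewrite ux.
Qed.

End SolitonParametrization.

Section TranslatingFamily.
Context {R : realType} {m : nat} (hm : (0 < m)%N).
Variables (alpha : R) (a : 'rV[R]_m).
Hypotheses (alpha_gt0 : 0 < alpha) (ap : all_pos a).
Let alpha0 := ltW alpha_gt0.
Let F := soliton_param alpha a (- (pi / 2 / alpha)).

(** The imaginary part of the last coordinate is - 1 / alpha times the angle of
    angle_psi. *)
Lemma L_pos_range : L_pos alpha a = range F.
Proof.
have im_last y : - (alpha^-1 * \sum_j phi alpha a j y) -
    alpha^-1 * Defs.arg (y +i* (Num.sqrt (P alpha a y))^-1)%C =
    psi alpha a y - pi / 2 / alpha.
  have := angle_psi hm alpha0 ap y.
  move: (\sum_j _) (Defs.arg _) => s t /(canRL (addKr _)) ->.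
  by field; rewrite gt_eqF.
rewrite range_soliton_param; apply/seteqP; split => _ [x [y ->]];
  by exists x, y; congr soliton_point; congr (_ +i* _)%C; rewrite im_last.
Qed.

(** On L_pos the Lagrangian angle is a linear function of the ambient space,
    hence continuous. *)
Definition soliton_angle (w : Cn R m.+1) : R := - alpha * last_coord w.

Lemma soliton_angle_param u :
  soliton_angle (F u) = pi / 2 - alpha * psi alpha a (u ord0 ord_max).
Proof.
by rewrite /soliton_angle last_coord_param; field; rewrite gt_eqF.
Qed.

Lemma soliton_angleP : lagrangian_angle (L_pos alpha a) soliton_angle.
Proof.
split.
  apply: continuous_subspaceT => w; apply: cvgM; first exact: cvg_cst.
  exact: last_coord_continuous.
rewrite L_pos_range; exists F.
  exact: soliton_param_parametrizes.
exists false => u; rewrite expr0 mul1r soliton_angle_param.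
exact: soliton_param_angle.
Qed.

Let D := pi / 2 - rowsum (phibar alpha a).

Let Fy (y : R) : exists u, soliton_angle (F u) = pi / 2 - alpha * psi alpha a y.
Proof. by exists (\row_k y); rewrite soliton_angle_param mxE. Qed.

Lemma inf_soliton_angle :
  inf_on (L_pos alpha a) soliton_angle = (rowsum (phibar alpha a))%:E.
Proof.
rewrite /inf_on L_pos_range; apply/eqP; rewrite eq_le; apply/andP; split.
  rewrite leNgt; apply/negP.
  set I := ereal_inf _ => SI.
  have Iy y : (I <= (pi / 2 - alpha * psi alpha a y)%:E)%E.
    have [u uE] := Fy y; rewrite -uE.
    by apply: ereal_inf_lbound; exists (F u) => //; exists u.
  move: SI Iy; case: I => [i| |] //; last by move=> _ /(_ 0).
  rewrite lte_fin => SI iy; move: SI; apply/negP; rewrite -leNgt.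
  have h : D <= pi / 2 - i.
    apply: (lim_le_bound (alpha_psi_cvgy hm alpha0 ap)) => y _.
    by have := iy y; rewrite lee_fin lerBrDr addrC -lerBrDr.
  by move: h; rewrite lerD2l lerN2.
apply: le_ereal_inf_tmp => _ [_ [u _ <-] <-].
rewrite lee_fin soliton_angle_param lerBrDr addrC -lerBrDr.
exact: alpha_psi_le.
Qed.

Lemma sup_soliton_angle :
  sup_on (L_pos alpha a) soliton_angle = (pi - rowsum (phibar alpha a))%:E.
Proof.
rewrite /sup_on L_pos_range.
have pE : pi - rowsum (phibar alpha a) = pi / 2 + D by rewrite /D; field.
apply/eqP; rewrite pE eq_le; apply/andP; split.
  apply: ge_ereal_sup => _ [_ [u _ <-] <-].
  rewrite lee_fin soliton_angle_param lerD2l -mulrN -(psi_odd hm alpha0 ap).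
  exact: alpha_psi_le.
rewrite leNgt; apply/negP.
set I := ereal_sup _ => SI.
have Iy y : ((pi / 2 + alpha * psi alpha a y)%:E <= I)%E.
  have [u uE] := Fy (- y).
  rewrite -[alpha * _]opprK -mulrN -(psi_odd hm alpha0 ap) -uE.
  by apply: ereal_sup_ubound; exists (F u) => //; exists u.
move: SI Iy; case: I => [i| |] //; last by move=> _ /(_ 0).
rewrite lte_fin => SI iy; move: SI; apply/negP; rewrite -leNgt.
rewrite -lerBrDl.
apply: (lim_le_bound (alpha_psi_cvgy hm alpha0 ap)) => y _.
by have := iy y; rewrite lee_fin -lerBrDl.
Qed.

Lemma L_pos_soliton :
  [/\ closed (L_pos alpha a), embedded_Rn (L_pos alpha a),
      lagrangian (L_pos alpha a) &
      translating_soliton (translating_vector alpha) (L_pos alpha a)].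
Proof.
have pF : parametrizes F (L_pos alpha a).
  by rewrite L_pos_range; exact: soliton_param_parametrizes.
split; [|by exists F|exists F => //|exists F => //].
- by rewrite L_pos_range; exact: soliton_param_closed.
- exact: soliton_param_lagrangian.
- exact: soliton_param_translating.
Qed.

End TranslatingFamily.

Lemma L_zero_special (R : realType) (m : nat) (a : 'rV[R]_m) :
  (0 < m)%N -> all_pos a ->
  [/\ closed (L_zero a), embedded_Rn (L_zero a),
      lagrangian (L_zero a) & special_lagrangian (L_zero a)].
Proof.
move=> hm ap; have z0 : 0 <= 0 :> R by [].
pose F := soliton_param 0 a 0.
have LE : L_zero a = range F.
  rewrite range_soliton_param; apply/seteqP; split => _ [x [y ->]];
    by exists x, y; congr soliton_point; congr (_ +i* _)%C; rewrite addr0.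
have pF : parametrizes F (L_zero a).
  by rewrite LE; exact: soliton_param_parametrizes.
have lF : lagrangian (L_zero a).
  by exists F => //; exact: soliton_param_lagrangian.
split=> //; first by rewrite LE; exact: soliton_param_closed.
  by exists F.
split=> //; exists (pi / 2); split.
  by apply: continuous_subspaceT => w; exact: cvg_cst.
exists F => //; exists false => u; rewrite expr0 mul1r.
have := soliton_param_angle hm z0 ap 0 u.
by rewrite mul0r subr0.
Qed.

Theorem corollaryI (R : realType) (m : nat) (hm : (1 <= m)%N) :
  (* L is a translating soliton if alpha > 0, special Lagrangian if alpha = 0 *)
  (forall (alpha : R) (a : 'rV[R]_m), 0 < alpha -> all_pos a ->
     [/\ closed (L_pos alpha a), embedded_Rn (L_pos alpha a),
         lagrangian (L_pos alpha a) &
         translating_soliton (translating_vector alpha) (L_pos alpha a)]) /\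
  (forall a : 'rV[R]_m, all_pos a ->
     [/\ closed (L_zero a), embedded_Rn (L_zero a),
         lagrangian (L_zero a) & special_lagrangian (L_zero a)]) /\
  (* the limits of the phi_j *)
  (forall (alpha : R) (a : 'rV[R]_m), 0 <= alpha -> all_pos a ->
     [/\ (forall j, [/\ 0 < phibar alpha a ord0 j <= pi / 2,
            phi alpha a j y @[y --> +oo] --> phibar alpha a ord0 j &
            phi alpha a j y @[y --> -oo] --> - phibar alpha a ord0 j]),
         (0 < alpha -> rowsum (phibar alpha a) < pi / 2) &
         (alpha = 0 -> rowsum (phibar alpha a) = pi / 2)]) /\
  (* the map a |-> phibar *)
  (forall alpha : R, 0 < alpha ->
     set_bij [set a : 'rV[R]_m | all_pos a]
       [set b : 'rV[R]_m |
          (forall j, 0 < b ord0 j < pi / 2) /\ rowsum b < pi / 2]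
       (phibar alpha)) /\
  (phibar 0 @` [set a : 'rV[R]_m | all_pos a] =
     [set b : 'rV[R]_m |
        (forall j, 0 < b ord0 j <= pi / 2) /\ rowsum b = pi / 2]) /\
  (* the Lagrangian angle *)
  (forall (alpha : R) (a : 'rV[R]_m), 0 < alpha -> all_pos a ->
     exists theta, [/\ lagrangian_angle (L_pos alpha a) theta,
       inf_on (L_pos alpha a) theta = (rowsum (phibar alpha a))%:E &
       sup_on (L_pos alpha a) theta = (pi - rowsum (phibar alpha a))%:E]) /\
  (forall alpha e : R, 0 < alpha -> 0 < e ->
     exists d : R, [/\ 0 < d,
       (exists a : 'rV[R]_m,
          all_pos a /\ pi / 2 - d < rowsum (phibar alpha a)) &
       (forall a : 'rV[R]_m,
          all_pos a -> pi / 2 - d < rowsum (phibar alpha a) ->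
          exists2 theta, lagrangian_angle (L_pos alpha a) theta &
            (oscillation (L_pos alpha a) theta < e%:E)%E)]).
Proof.
split; first by move=> alpha a al ap; exact: L_pos_soliton.
split; first by move=> a; exact: L_zero_special.
split.
  move=> alpha a al ap; split; last 2 first.
  - exact: rowsum_phibar_lt.
  - exact: rowsum_phibar_eq.
  move=> j; split; [|exact: phi_cvgy|exact: phi_cvgNy].
  rewrite phibar_gt0//=; apply: phibar_le_bound => // y _.
  exact/ltW/phi_lt_pihalf.
split; first by move=> alpha al; exact: phibar_bij.
split; first exact: phibar0_image.
split.
  move=> alpha a al ap; exists (soliton_angle alpha); split.
  - exact: soliton_angleP.
  - exact: inf_soliton_angle.
  - exact: sup_soliton_angle.
move=> alpha e al e0; exists (e / 2); split; first by rewrite divr_gt0.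
  (* A preimage of (s/m, ..., s/m) with s slightly less than pi / 2. *)
  pose p2 : R := pi / 2.
  have p20 : 0 < p2 by rewrite divr_gt0 ?pi_gt0.
  have [s s0 [se sp]] : exists2 s : R, 0 < s & p2 - e / 2 < s /\ s < p2.
    have [ep|pe] := leP p2 (e / 2).
      by exists (p2 / 2); clear -p20 ep; lra.
    by exists (p2 - e / 4); clear -p20 pe e0; lra.
  have m0 : 0 < m%:R :> R by rewrite ltr0n.
  have bs : rowsum (\row_(j < m) (s / m%:R)) = s.
    rewrite /rowsum; under eq_bigr do rewrite mxE.
    by rewrite sumr_const card_ord -[LHS]mulr_natr divfK// gt_eqF.
  have [_ _ surj] := @phibar_bij R m hm alpha al.
  have [|a ap aE] := surj (\row_(j < m) (s / m%:R)).
    split; last by rewrite bs.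
    move=> j; rewrite mxE divr_gt0//=; apply: le_lt_trans sp.
    by rewrite ler_pdivrMr// ler_peMr ?ler1n// ltW.
  by exists a; split=> //; rewrite aE bs.
move=> a ap aS; exists (soliton_angle alpha); first exact: soliton_angleP.
rewrite /oscillation sup_soliton_angle// inf_soliton_angle// -EFinB lte_fin.
move: aS; move: (rowsum _) => S; have -> : pi = 2 * (pi / 2) :> R by field.
move: (pi / 2) => p2; clear; lra.
Qed.
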